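(* Let $(M,\rho,\mu)$ be a space of homogeneous type with $\mu$ $\sigma$-finite and $\mu(M)=\infty$. Suppose that $q\in(1,\infty)$ and that $T$ is a linear operator defined on $H^{1,q}_{\mathrm{fin}}(M)$, with values in $L^1(M)$, such that $$\sup\{\|Ta\|_{L^1(M)} : a \text{ is a } (1,q)\text{-atom}\}<\infty.$$ Then there exists a unique bounded linear operator $\widetilde T$ from $H^1(M)$ to $L^1(M)$ which extends $T$.
   Context: A space of homogeneous type (in the sense of Coifman and Weiss) is a set $M$ with a quasi-metric $\rho$ (i.e. $\rho\ge0$ is symmetric, vanishes exactly on the diagonal, and $\rho(x,y)\le K(\rho(x,z)+\rho(z,y))$ for some constant $K$), whose balls define the topology of $M$, together with a positive Borel measure $\mu$ such that balls are measurable with positive finite measure and $\mu$ is doubling: there is a constant $C$ with $\mu(B(x,2r))\le C\mu(B(x,r))$ for all $x\in M$, $r>0$. For $q\in(1,\infty]$, a $(1,q)$-atom is a function $a\in L^q(M)$ supported in a (closed) ball $B$, with $\int a\,d\mu=0$, and such that $\bigl(\frac1{\mu(B)}\int_B|a|^q\,d\mu\bigr)^{1/q}\le\mu(B)^{-1}$ if $q<\infty$, respectively $\|a\|_\infty\le\mu(B)^{-1}$ if $q=\infty$. $H^{1,q}(M)$ is the space of all $g\in L^1(M)$ that can be written $g=\sum_j\lambda_j a_j$ with $a_j$ $(1,q)$-atoms and $\lambda_j\in\mathbb{C}$, $\sum_j|\lambda_j|<\infty$; its norm is the infimum of $\sum_j|\lambda_j|$ over all such decompositions. It is well known that all the spaces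 $H^{1,q}(M)$, $q\in(1,\infty]$, coincide with equivalent norms; the common space is denoted $H^1(M)$. $H^{1,q}_{\mathrm{fin}}(M)$ is the vector space of all finite linear combinations of $(1,q)$-atoms. *)

(* Defs.v *)
From mathcomp Require Import all_boot all_order all_algebra.
From mathcomp Require Import all_classical all_reals all_analysis.
From mathcomp Require Import complex.
Set Implicit Arguments.
Unset Strict Implicit.
Unset Printing Implicit Defensive.
Import Order.TTheory GRing.Theory Num.Theory.
Import numFieldNormedType.Exports.

Local Open Scope classical_set_scope.
Local Open Scope ring_scope.
Local Open Scope complex_scope.

Section quasi_metric.
Context {R : realType} {M : Type}.
Implicit Types (rho : M -> M -> R) (x : M) (r : R).

Definition qball rho x r : set M := [set y | rho x y < r].

Definition closed_qball rho x r : set M := [set y | rho x y <= r].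

(* The topology defined by the balls.  For a quasi-metric the balls need not be
   open, but they are neighbourhoods of their centres in this topology. *)
Definition qopen rho : set (set M) :=
  [set U | forall x, U x -> exists2 r, 0 < r & qball rho x r `<=` U].

Record quasi_metric rho : Prop := QuasiMetric {
  qm_ge0 : forall x y, 0 <= rho x y ;
  qm_sym : forall x y, rho x y = rho y x ;
  qm_eq0 : forall x y, rho x y = 0 <-> x = y ;
  qm_triangle : exists K : R, forall x y z,
    rho x y <= K * (rho x z + rho z y) }.

End quasi_metric.

Section homogeneous_type.
Context {R : realType} {d : measure_display} {M : measurableType d}.

(* [M] carries exactly the Borel sigma-algebra of the topology of [rho].
   Measurability, finiteness, positivity and doubling are required of open
   balls; each is equivalent (up to the doubling constant) to its analogue for
   closed balls. *)
Record homogeneous_type (rho : M -> M -> R) (mu : {measure set M -> \bar R})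
  : Prop := HomogeneousType {
  ht_quasi_metric : quasi_metric rho ;
  ht_borel : (measurable : set (set M)) = <<s qopen rho >> ;
  ht_measurable_ball : forall x r, measurable (qball rho x r) ;
  ht_ball_gt0 : forall x r, 0 < r -> (0 < mu (qball rho x r))%E ;
  ht_ball_fin : forall x r, 0 < r -> (mu (qball rho x r) < +oo)%E ;
  ht_doubling : exists C : R, forall x r, 0 < r ->
    (mu (qball rho x (2 * r)) <= C%:E * mu (qball rho x r))%E }.

End homogeneous_type.

(* Elements of L^p are represented by functions [M -> R[i]], considered up to
   equality mu-almost everywhere. *)
Section complex_Lp.
Context {R : realType} {d : measure_display} {M : measurableType d}.
Variable mu : {measure set M -> \bar R}.
Implicit Types (f g : M -> R[i]) (p : \bar R).

Definition cabs (z : R[i]) : R := Normc.normc z.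

Definition cmeasurable f : Prop :=
  measurable_fun setT (fun x => complex.Re (f x)) /\
  measurable_fun setT (fun x => complex.Im (f x)).

Definition cLnorm p f : \bar R := ('N[mu]_p[EFin \o (cabs \o f)])%E.

Definition cLp p : set (M -> R[i]) :=
  [set f | cmeasurable f /\ (cLnorm p f < +oo)%E].

Definition cintegral f : R[i] :=
  (\int[mu]_x complex.Re (f x)) +i* (\int[mu]_x complex.Im (f x)).

(* A linear operator from the space of classes of elements of [D] to L^1: on
   representatives, it is linear and compatible with equality a.e.  The values
   of [T] outside [D] are irrelevant. *)
Record linear_to_L1 (D : set (M -> R[i])) (T : (M -> R[i]) -> (M -> R[i]))
  : Prop := LinearToL1 {
  lin_L1 : forall f, D f -> cLp 1%E (T f) ;
  lin_ae : forall f g, D f -> D g ->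
    f = g %[ae mu] -> T f = T g %[ae mu] ;
  lin_linear : forall (c : R[i]) f g, D f -> D g ->
    T (fun x => c * f x + g x) = (fun x => c * T f x + T g x) %[ae mu] }.

End complex_Lp.

Section atomic_hardy.
Context {R : realType} {d : measure_display} {M : measurableType d}.
Variables (rho : M -> M -> R) (mu : {measure set M -> \bar R}) (q : R).
Implicit Types (a g : M -> R[i]).

(* (1,q)-atoms, for 1 < q < oo.  Being supported in a ball is, as for any
   element of L^q, understood up to a null set. *)
Definition atom a : Prop := exists (x0 : M) (r : R), 0 < r /\
  let B := closed_qball rho x0 r in
  [/\ cLp mu q%:E a,
      {ae mu, forall x, ~ B x -> a x = 0},
      cintegral mu a = 0 &
      (((mu B)^-1 * \int[mu]_(x in B) ((cabs (a x)) `^ q)%:E) `^ q^-1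
        <= (mu B)^-1)%E].

Definition Hfin : set (M -> R[i]) := [set g | cLp mu 1%E g /\
  exists (n : nat) (lam : 'I_n -> R[i]) (a : 'I_n -> M -> R[i]),
    (forall j, atom (a j)) /\
    g = (fun x => \sum_(j < n) lam j * a j x) %[ae mu]].

(* g = \sum_j lam_j a_j, the series being convergent in L^1 *)
Definition atomic_decomposition g (lam : nat -> R[i])
    (a : nat -> M -> R[i]) : Prop :=
  [/\ forall j, atom (a j),
      (\sum_(0 <= j <oo) (cabs (lam j))%:E < +oo)%E &
      cLnorm mu 1%E (fun x => g x - \sum_(0 <= j < n) lam j * a j x)
        @[n --> \oo] --> 0%E].

(* H^{1,q}; for every q > 1 this is the space H^1, with an equivalent norm. *)
Definition H1 : set (M -> R[i]) := [set g | cLp mu 1%E g /\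
  exists (lam : nat -> R[i]) (a : nat -> M -> R[i]),
    atomic_decomposition g lam a].

Definition H1norm g : \bar R := ereal_inf
  [set s | exists (lam : nat -> R[i]) (a : nat -> M -> R[i]),
    atomic_decomposition g lam a /\
    s = (\sum_(0 <= j <oo) (cabs (lam j))%:E)%E].

Definition bounded_H1_L1 (T : (M -> R[i]) -> (M -> R[i])) : Prop :=
  exists C : R, forall f, H1 f ->
    (cLnorm mu 1%E (T f) <= C%:E * H1norm f)%E.

Definition bounded_extension (T S : (M -> R[i]) -> (M -> R[i])) : Prop :=
  [/\ linear_to_L1 mu H1 S,
      bounded_H1_L1 S &
      forall f, Hfin f -> S f = T f %[ae mu]].

End atomic_hardy.

(* Main.v *)
(* Proof idea.  Everything reduces to a bound [||T g||_1 <= C N(g)] for [g] in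
   [Hfin], where [N(g)] is the supremum of [|int g beta|] over bounded [beta]
   with [|int a beta| <= 1] for every atom [a]: [N] is at most [2 sum |lam_j|] on
   a finite combination, and is lower semicontinuous for L^1 convergence because
   the [beta] are bounded.  So partial sums of an infinite atomic decomposition
   are Cauchy for [N], and [T] extends by continuity.

   For the bound, pair the real and imaginary parts of [T f] with their signs.
   The resulting real functional is bounded on atoms, hence continuous on mean
   zero functions of L^q(B) for each ball [B]; as q < oo, Radon-Nikodym
   represents it by a locally integrable [b], a BMO function.  The truncations
   [b_N] are multiples of admissible [beta], uniformly in [N], and
   [int g b_N --> int g b] by dominated convergence. *)
From HB Require Import structures.
Require Import Defs.
From mathcomp Require Import all_boot all_order all_algebra.
From mathcomp Require Import all_classical all_reals all_analysis.
From mathcomp Require Import measurable_realfun.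
From mathcomp Require Import complex ring lra.
Import Order.TTheory GRing.Theory Num.Theory.
Import numFieldNormedType.Exports.
Local Open Scope classical_set_scope.
Local Open Scope ring_scope.
Local Open Scope complex_scope.

Set Implicit Arguments.
Unset Strict Implicit.
Unset Printing Implicit Defensive.

(** * Representation of functionals by a density *)

(** The bound on atoms controls [T g] by [sum |lam_j|] over finite decompositions of [g] only,
    whereas the H^1 norm is an infimum over infinite ones, and [T] cannot be applied term by term to
    an infinite series. Pairing with a density removes the obstacle, because [int g b] depends on
    [g] and not on a way of writing it. An unbounded [b], however, does not pass through L^1 limits,
    hence the truncations. They stay admissible for two reasons: an atom has mean zero, so any
    constant may be subtracted from [b], and clamping is 1-Lipschitz, so it does not increase the
    distance of [b] to a constant.

    The constants: 8 is the cost of truncation; 32 = 8 * 4 comes from splitting both the argument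
    and the value of [T] into real and imaginary parts; 64 adds a factor 2, the cost of a complex
    coefficient for [N].

    Uniqueness uses the tails of a decomposition: they are in H^1 with norm at most the tail of
    [sum |lam_j|], so every bounded extension is the L^1 limit of [T] on the partial sums. *)

Section riesz_representation.
Context {d : measure_display} {X : measurableType d} {R : realType}.
Variable mu : {sigma_finite_measure set X -> \bar R}.
Variables (W : set (X -> R)) (B : (set X)^nat) (v : (X -> R) -> R).
Hypothesis Wmeasurable : forall f : X -> R, W f -> measurable_fun setT f.
Hypothesis Wsolid : forall f g : X -> R, W g -> measurable_fun setT f ->
  (forall x, `|f x| <= `|g x|) -> W f.
Hypothesis Wlinear : forall (c : R) (f g : X -> R), W f -> W g -> W (fun x => c * f x + g x).
Hypothesis mB : forall n, measurable (B n).
Hypothesis ndB : nondecreasing_seq B.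
Hypothesis BT : \bigcup_n B n = setT.
Hypothesis WB : forall n, W (\1_(B n)).
Hypothesis Wsupport : forall f : X -> R, W f -> exists n, forall x, ~ B n x -> f x = 0.
Hypothesis v_linear : forall (c : R) (f g : X -> R), W f -> W g ->
  v (fun x => c * f x + g x) = c * v f + v g.
Hypothesis v_null : forall f : X -> R, W f -> {ae mu, forall x, f x = 0} -> v f = 0.
Hypothesis v_continuous : forall (f_ : (X -> R)^nat) f, W f ->
  (forall n, measurable_fun setT (f_ n)) ->
  (forall n x, `|f_ n x| <= `|f x|) ->
  (forall x, f_ ^~ x @ \oo --> f x) ->
  v (f_ n) @[n --> \oo] --> v f.

Let D := seqD B.

Let mD n : measurable (D n).
Proof. by case: n => [|n] //=; exact: measurableD. Qed.

Let DB n : D n `<=` B n.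
Proof. by case: n => [|n] //= x []. Qed.

Let DT : \bigcup_n D n = setT.
Proof. by rewrite eq_bigcup_seqD. Qed.

Let DI n m x : D n x -> D m x -> n = m.
Proof.
move=> Dn Dm; apply: (trivIset_seqD ndB) => //; by exists x.
Qed.

Let W0 : W (cst 0).
Proof. by apply: (Wsolid (WB 0)) => // x; rewrite normr0. Qed.

Let v0 : v (cst 0) = 0.
Proof. by apply: v_null => //; exact: aeW. Qed.

Let Windic n E : measurable E -> E `<=` B n -> W (\1_E).
Proof.
move=> mE EB; apply: (Wsolid (WB n)); first exact: measurable_indic.
move=> x; rewrite !indicE !normr_nat ler_nat.
by case: (boolP (x \in E)) => // /set_mem /EB /mem_set ->.
Qed.

(** Intersecting with one piece [D n] of the disjointed exhaustion keeps every indicator below that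
    of [B n], hence in [W], so the set function is finite on all measurable sets. Densities are
    therefore found piece by piece and glued. *)
Definition functional_charge n (E : set X) : \bar R := (v (\1_(E `&` D n)))%:E.

Let charge_n n := functional_charge n.

Let charge0_n n : charge_n n set0 = 0%E.
Proof. by rewrite /charge_n /functional_charge set0I indic0 v0. Qed.

Let charge_fin n E : measurable E -> charge_n n E \is a fin_num.
Proof. by []. Qed.

Let vU E F n : measurable E -> measurable F -> E `<=` B n -> F `<=` B n ->
  E `&` F = set0 -> v (\1_(E `|` F)) = v (\1_E) + v (\1_F).
Proof.
move=> mE mF EB FB EF0.
have -> : \1_(E `|` F) = (fun x => 1 * \1_E x + \1_F x) :> (X -> R).
  apply/funext => x; rewrite !indicE mul1r in_setU -natrD; congr (_%:R).
  case: (boolP (x \in E)) => //= xE; case: (boolP (x \in F)) => //= xF.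
  have : (E `&` F) x by split; exact: set_mem.
  by rewrite EF0.
by rewrite v_linear ?mul1r//; apply: (@Windic n).
Qed.

(** The indicators of the partial unions are dominated by that of the full union and eventually
    equal to it at each point, so countable additivity is an instance of [v_continuous]. *)
Let charge_sigma n : semi_sigma_additive (charge_n n).
Proof.
move=> F mF tF mUF.
pose U k := (\big[setU/set0]_(i < k) F i) `&` D n.
have mU k : measurable (U k).
  by apply: measurableI => //; apply: bigsetU_measurable.
have -> : (fun k => \sum_(0 <= i < k) charge_n n (F i))%E =
          (fun k => (v (\1_(U k)))%:E).
  apply/funext; elim => [|k ih].
    by rewrite big_nil /U big_ord0 set0I indic0 v0.
  rewrite big_nat_recr//= ih /charge_n /functional_charge -EFinD; congr EFin.
  rewrite /U big_ord_recr/= setIUl (@vU _ _ n)//.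
  - exact: mU.
  - exact: measurableI.
  - by move=> x [_ /DB].
  - by move=> x [_ /DB].
  - apply/seteqP; split => // x [[Ux Dx] [Fx _]].
    have [i ik Fi] : exists2 i, (i < k)%N & F i x.
      by move: Ux; rewrite -bigcup_mkord => -[i /= ik Fi]; exists i.
    by have := tF i k I I (ex_intro _ x (conj Fi Fx)) => E; rewrite E ltnn in ik.
apply: cvg_EFin; first by near=> k.
apply: v_continuous => //.
- by apply: (@Windic n) => [|x [_ /DB]//]; exact: measurableI.
- move=> k x; rewrite !indicE !normr_nat ler_nat.
  case: (boolP (x \in U k)) => // /set_mem [Ux Dx].
  rewrite mem_set//; split => //.
  by move: Ux; rewrite -bigcup_mkord => -[i /= ik Fi]; exists i.
- move=> x; have [[[i _ Fi] Dx]|nx] := pselect ((\bigcup_n F n `&` D n) x).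
    apply: cvg_near_cst; near=> k.
    rewrite !indicE !mem_set//; first by split => //; exists i.
    split => //; rewrite -bigcup_mkord; exists i => //=.
    by near: k; exact: nbhs_infty_gt.
  apply: cvg_near_cst; near=> k.
  rewrite !indicE !memNset// => -[Ux Dx]; apply: nx; split => //.
  by move: Ux; rewrite -bigcup_mkord => -[j /= ik Fj]; exists j.
Unshelve. all: by end_near. Qed.

HB.instance Definition _ n := isCharge.Build _ _ _ (functional_charge n)
  (charge0_n n) (@charge_fin n) (@charge_sigma n).

Let charge_dom n : functional_charge n `<< mu.
Proof.
apply/null_content_dominatesP => E mE E0; rewrite /functional_charge v_null//.
  by apply: (@Windic n) => [|x [_ /DB]//]; exact: measurableI.
exists E; split => // x /=; apply: contra_notP => nEx.
by rewrite indicE memNset// => -[].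
Qed.

Let dens n x : R := fine (Radon_Nikodym (functional_charge n) mu x).

Let dens_integrable n : mu.-integrable setT (EFin \o dens n).
Proof.
apply: (@eq_integrable _ _ _ mu setT measurableT
  (Radon_Nikodym (functional_charge n) mu)).
  by move=> x _; rewrite /= fineK// (Radon_Nikodym_fin_num _ (charge_dom n)).
exact: Radon_Nikodym_integrable (charge_dom n).
Qed.

Let densE n E : measurable E -> E `<=` D n ->
  (\int[mu]_(x in E) (dens n x)%:E)%E = (v (\1_E))%:E.
Proof.
move=> mE ED; have <- : functional_charge n E = (v (\1_E))%:E.
  by rewrite /functional_charge setIidl.
rewrite [RHS](Radon_Nikodym_integral (charge_dom n) mE).
apply: eq_integral => x _.
by rewrite fineK// (Radon_Nikodym_fin_num _ (charge_dom n)).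
Qed.

Let ex_idx x : {n | D n x}.
Proof.
apply: cid; have [n _ Dn] : (\bigcup_n D n) x by rewrite DT.
by exists n.
Qed.

Let b x : R := dens (sval (ex_idx x)) x.

Let bE n x : D n x -> b x = dens n x.
Proof. by rewrite /b; case: ex_idx => m /= Dm Dn; rewrite (DI Dm Dn). Qed.

Let mb : measurable_fun setT b.
Proof.
rewrite -DT; apply/measurable_fun_bigcup => // n.
apply: (@eq_measurable_fun _ _ _ _ _ (dens n)).
  by move=> x /set_mem Dx; rewrite (bE Dx).
apply: measurable_funTS.
by have /measurable_int/measurable_EFinP := dens_integrable n.
Qed.

(** Integrability of [f * b] is part of the claim: [b] is only known to be integrable on each [D n],
    and the integrability of the product has to come out of the finiteness of [v f]. *)
Let representable (f : X -> R) := mu.-integrable setT (fun x => (f x * b x)%:E) /\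
  (\int[mu]_x (f x * b x)%:E)%E = (v f)%:E.

Let representable_lin c f g : W f -> W g -> representable f ->
  representable g -> representable (fun x => c * f x + g x).
Proof.
move=> Wf Wg [fi fE] [gi gE].
have eq x : ((c * f x + g x) * b x)%:E =
    (c%:E * (f x * b x)%:E + (g x * b x)%:E)%E.
  by rewrite -EFinM -EFinD mulrDl mulrA.
split.
  apply: (@eq_integrable _ _ _ mu setT measurableT
     ((fun x => c%:E * (f x * b x)%:E)%E \+ (fun x => (g x * b x)%:E))%E).
    by move=> x _; rewrite eq.
  by apply: integrableD => //; exact: integrableZl.
under eq_integral do rewrite eq.
rewrite integralD//; last exact: integrableZl.
by rewrite integralZl// fE gE v_linear// -EFinM -EFinD.
Qed.

Let representable0 : representable (cst 0).
Proof.
have eq x : ((cst 0 : X -> R) x * b x)%:E = 0%E by rewrite mul0r.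
split.
  by apply: (@eq_integrable _ _ _ mu setT measurableT (cst 0%E)) => //; exact: integrable0.
by under eq_integral do rewrite eq; rewrite integral0 v0.
Qed.

Let representable_indic n E : measurable E -> E `<=` D n -> representable (\1_E).
Proof.
move=> mE ED.
have eq x : (\1_E x * b x)%:E = ((EFin \o dens n) \_ E) x.
  rewrite /patch indicE; case: ifPn => xE; last by rewrite mul0r.
  by rewrite mul1r/= (@bE n)//; apply: ED; exact: set_mem.
split.
  apply: (@eq_integrable _ _ _ mu setT measurableT ((EFin \o dens n) \_ E)).
    by move=> x _.
  apply/(integrable_mkcond _ mE).
  exact: (integrableS measurableT mE _ (dens_integrable n)).
under eq_integral do rewrite eq.
by rewrite -integral_mkcond (densE mE ED).
Qed.

Import HBNNSimple.

Let representable_simple n (h : {nnsfun X >-> R}) :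
  (forall x, ~ D n x -> h x = 0) -> W h /\ representable h.
Proof.
move=> h0.
(* The value 0 is removed from the range because its level set need not lie in [D n]. *)
have -> : (h : X -> R) = (fun x => \sum_(y <- finmap.enum_fset (fset_set (range h `\ 0)))
    y * \1_(h @^-1` [set y]) x).
  apply/funext => x; rewrite fimfunE -fsbig_finite//=; last exact: finite_setD.
  apply/esym/fsbig_widen; first by move=> y [].
  by move=> y [yh /= /not_andP[//|/contrapT ->]]; rewrite mul0r.
have : forall y, y \in finmap.enum_fset (fset_set (range h `\ 0)) -> y != 0.
  move=> y; rewrite in_fset_set; last exact: finite_setD.
  by rewrite inE => -[_ /eqP].
elim: (finmap.enum_fset _) => [_|y s ih yn0].
  under eq_fun do rewrite big_nil.
  by split => //; exact: W0.
have {}ih : W (fun x => \sum_(y <- s) y * \1_(h @^-1` [set y]) x) /\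
    representable (fun x => \sum_(y <- s) y * \1_(h @^-1` [set y]) x).
  by apply: ih => z zs; apply: yn0; rewrite in_cons zs orbT.
case: ih => Ws rs.
have mE : measurable (h @^-1` [set y]) by exact: measurable_sfunP.
have ED : h @^-1` [set y] `<=` D n.
  move=> x /= hx; apply: contrapT => /h0; rewrite hx => y0.
  by have := yn0 y (mem_head _ _); rewrite y0 eqxx.
have We : W (\1_(h @^-1` [set y])).
  by apply: (@Windic n) => // x /ED /DB.
under eq_fun do rewrite big_cons.
split; first exact: Wlinear.
by apply: representable_lin => //; exact: (@representable_indic n).
Qed.

(* [b] has constant sign on the support of [f], so monotone convergence applies
   to simple functions increasing to [f]. *)
Let representable_sign n (s : bool) f : W f -> (forall x, 0 <= f x) ->
  (forall x, ~ (D n x /\ 0 <= (-1) ^+ s * b x) -> f x = 0) -> representable f.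
Proof.
move=> Wf f0 fD.
have mf := Wmeasurable Wf.
have mEf : measurable_fun setT (EFin \o f) by exact/measurable_EFinP.
pose h k := nnsfun_approx measurableT mEf k.
have hf k x : 0 <= h k x <= f x.
  by rewrite fun_ge0/= -lee_fin /h nnsfun_approxE le_approx// => y _; rewrite lee_fin.
have h0 k x : ~ D n x -> h k x = 0.
  move=> Dx; apply/eqP; rewrite eq_le; have /andP[-> h1] := hf k x.
  by rewrite andbT (le_trans h1)// fD// => -[].
have hr k : representable (h k) by have [] := representable_simple (h0 k).
have hcvg x : h ^~ x @ \oo --> f x.
  have : (EFin \o h ^~ x) @ \oo --> (EFin \o f) x.
    by apply: cvg_nnsfun_approx => // y _; rewrite lee_fin.
  by move/fine_cvgP => [].
have vh : v (h k) @[k --> \oo] --> v f.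
  apply: v_continuous => //; move=> k x.
  by have /andP[h1 h2] := hf k x; rewrite !ger0_norm// (le_trans h1).
have sb k x : 0 <= h k x * ((-1) ^+ s * b x).
  have [[_ ?]|nx] := pselect (D n x /\ 0 <= (-1) ^+ s * b x).
    by apply: mulr_ge0 => //; have /andP[] := hf k x.
  suff -> : h k x = 0 by rewrite mul0r.
  apply/eqP; rewrite eq_le; have /andP[-> h1] := hf k x.
  by rewrite andbT (le_trans h1)// fD.
have sbf x : 0 <= f x * ((-1) ^+ s * b x).
  have [[? ?]|nx] := pselect (D n x /\ 0 <= (-1) ^+ s * b x).
    exact: mulr_ge0.
  by rewrite fD// mul0r.
have mb' : measurable_fun setT (fun x => (-1) ^+ s * b x).
  exact: measurable_funM.
have eqs (g : X -> R) x :
    ((g x * ((-1) ^+ s * b x))%:E = ((-1) ^+ s)%:E * (g x * b x)%:E)%E.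
  by rewrite -EFinM mulrCA.
have ndh x m n' : (m <= n')%N -> h m x <= h n' x.
  by move=> mn; have /lefP := nd_nnsfun_approx measurableT mEf mn; exact.
have lim1 : (\int[mu]_x (h k x * ((-1) ^+ s * b x))%:E)%E @[k --> \oo] -->
    (\int[mu]_x (f x * ((-1) ^+ s * b x))%:E)%E.
  have -> : (\int[mu]_x (f x * ((-1) ^+ s * b x))%:E =
      \int[mu]_x limn (fun k => (h k x * ((-1) ^+ s * b x))%:E))%E.
    apply: eq_integral => x _; apply/esym/cvg_lim => //.
    by apply: cvg_EFin; [exact: nearW | apply: cvgMr_tmp; exact: hcvg].
  apply: cvg_monotone_convergence => //.
  - by move=> k; apply/measurable_EFinP; apply: measurable_funM.
  - by move=> k x _; rewrite lee_fin.
  - move=> x _ m m' mm'; rewrite lee_fin.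
    have [[_ ?]|nx] := pselect (D n x /\ 0 <= (-1) ^+ s * b x).
      by apply: ler_wpM2r => //; exact: ndh.
    have hx0 k : h k x = 0.
      apply/eqP; rewrite eq_le; have /andP[-> h1] := hf k x.
      by rewrite andbT (le_trans h1)// fD.
    by rewrite !hx0.
have lim2 : (\int[mu]_x (h k x * ((-1) ^+ s * b x))%:E)%E @[k --> \oo] -->
    ((-1) ^+ s * v f)%:E.
  have eqk k : (\int[mu]_x (h k x * ((-1) ^+ s * b x))%:E)%E =
      ((-1) ^+ s * v (h k))%:E.
    have [hi hE] := hr k.
    by under eq_integral do rewrite eqs; rewrite integralZl// hE.
  under eq_fun do rewrite eqk.
  by apply: cvg_EFin; [exact: nearW | apply: cvgMl_tmp; exact: vh].
have intE : (\int[mu]_x (f x * ((-1) ^+ s * b x))%:E)%E = ((-1) ^+ s * v f)%:E.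
  exact: (cvg_unique _ lim1 lim2).
have fbi : mu.-integrable setT (fun x => (f x * ((-1) ^+ s * b x))%:E).
  apply/integrableP; split; first by apply/measurable_EFinP; exact: measurable_funM.
  under eq_integral do rewrite gee0_abs ?lee_fin//.
  by rewrite intE ltry.
have eqs2 x : ((f x * b x)%:E = ((-1) ^+ s)%:E * (f x * ((-1) ^+ s * b x))%:E)%E.
  by rewrite -EFinM mulrCA (mulrA _ _ (b x)) -expr2 sqrr_sign mul1r.
split.
  apply: (@eq_integrable _ _ _ mu setT measurableT
    (fun x => ((-1) ^+ s)%:E * (f x * ((-1) ^+ s * b x))%:E)%E).
    by move=> x _; rewrite eqs2.
  exact: integrableZl.
under eq_integral do rewrite eqs2.
by rewrite integralZl// intE -EFinM mulrA -expr2 sqrr_sign mul1r.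
Qed.

Let representable_ge0 n f : W f -> (forall x, 0 <= f x) ->
  (forall x, ~ D n x -> f x = 0) -> representable f.
Proof.
move=> Wf f0 fD; have mf := Wmeasurable Wf.
pose P := [set x | 0 <= b x].
have mP : measurable P.
  rewrite (_ : P = setT `&` b @^-1` `[0, +oo[); first exact: mb.
  by apply/seteqP; split => x /=; rewrite in_itv/= andbT => // -[].
(* [g false] is [f] where [b] is nonnegative, [g true] is [f] where [b] is negative; the sign
   [(-1) ^+ s] makes [b] nonnegative on the support of each. *)
pose g (s : bool) x := f x * \1_(if s then ~` P else P) x.
have mg s : measurable_fun setT (g s).
  apply: measurable_funM => //; apply: measurable_indic.
  by case: s; [exact: measurableC|].
have gf s x : 0 <= g s x <= f x.
  by rewrite /g indicE; case: (_ \in _); rewrite ?mulr1 ?mulr0 ?f0/= ?lexx ?f0.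
have Wg s : W (g s).
  apply: (Wsolid Wf) => // x; have /andP[g0 gx] := gf s x.
  by rewrite !ger0_norm.
have rg s : representable (g s).
  apply: (@representable_sign n s) => //; first by move=> x; case/andP: (gf s x).
  move=> x /not_andP[Dx|bx]; first by rewrite /g fD// mul0r.
  rewrite /g indicE memNset ?mulr0//.
  move: bx; case: s; rewrite /P/= ?expr1 ?expr0 ?mul1r// mulN1r oppr_ge0 => bx.
  by move=> /negP; rewrite -ltNge => /ltW.
have -> : f = (fun x => 1 * g false x + g true x).
  apply/funext => x; rewrite /g mul1r -mulrDr !indicE in_setC.
  by case: (_ \in _); rewrite /= ?addr0 ?add0r mulr1.
exact: representable_lin.
Qed.

Let representable_D n f : W f -> (forall x, ~ D n x -> f x = 0) ->
  representable f.
Proof.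
move=> Wf fD; have mf := Wmeasurable Wf.
have Wa : W (fun x => `|f x|).
  by apply: (Wsolid Wf) => [|x]; [exact: measurableT_comp | rewrite normr_id].
have Wp : W (fun x => f x + `|f x|).
  by have := Wlinear 1 Wf Wa; under eq_fun do rewrite mul1r.
have -> : f = (fun x => (-1) * `|f x| + (f x + `|f x|)).
  by apply/funext => x; rewrite mulN1r addrCA addNr addr0.
apply: representable_lin => //; apply: (@representable_ge0 n) => //.
- by move=> x /fD ->; rewrite normr0.
- by move=> x; rewrite -lerBlDl sub0r -normrN ler_norm.
- by move=> x /fD ->; rewrite normr0 addr0.
Qed.

(** Continuity under dominated pointwise convergence takes the place of boundedness for a norm. It
    is used twice: for the countable additivity of the charges and for the passage from simple
    functions to all of [W]. *)
Lemma riesz_representation : exists2 b : X -> R, measurable_fun setT b &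
  forall f, W f -> mu.-integrable setT (fun x => (f x * b x)%:E) /\
    \int[mu]_x (f x * b x) = v f.
Proof.
exists b => // f Wf; suff [fi fE] : representable f by rewrite /Rintegral fE.
(* Induction on the index of a set [B n] supporting [f]; the step splits off the part of [f] on
   [D n.+1]. *)
have [n] := Wsupport Wf; elim: n f Wf => [|n ih] f Wf f0.
  exact: (@representable_D 0).
pose g x := f x * \1_(B n) x; pose h x := f x * \1_(D n.+1) x.
have mf := Wmeasurable Wf.
have cut (E : set X) : measurable E -> W (fun x => f x * \1_E x).
  move=> mE; apply: (Wsolid Wf).
    by apply: measurable_funM => //; exact: measurable_indic.
  by move=> x; rewrite indicE; case: (_ \in _); rewrite ?mulr1 ?mulr0 ?normr0.
have -> : f = (fun x => 1 * g x + h x).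
  apply/funext => x; rewrite /g /h mul1r -mulrDr !indicE in_setD.
  have [xB|xB] := boolP (x \in B n).
    by rewrite andbF addr0 mulr1.
  have [xB1|xB1] := boolP (x \in B n.+1); first by rewrite add0r mulr1.
  by rewrite f0 ?mul0r//; move: xB1; rewrite notin_setE.
apply: representable_lin; [exact: cut|exact: cut| |].
- by apply: ih => [|x Bx]; [exact: cut | rewrite /g indicE memNset ?mulr0].
- apply: (@representable_D n.+1); first exact: cut.
  by move=> x Dx; rewrite /h indicE memNset ?mulr0.
Qed.

End riesz_representation.

(** * Real powers, the complex modulus, complex measurable functions *)

Lemma powRD_le (R : realType) (q x y : R) : 0 <= q -> 0 <= x -> 0 <= y ->
  (x + y) `^ q <= 2 `^ q * (x `^ q + y `^ q).
Proof.
move=> q0 x0 y0; wlog xy : x y x0 y0 / x <= y => [th|].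
  have [|/ltW yx] := leP x y; first exact: th.
  by rewrite addrC (addrC (x `^ q)) th.
apply: (@le_trans _ _ ((2 * y) `^ q)).
  by rewrite ge0_ler_powR ?nnegrE ?addr_ge0 ?mulr_ge0// mulr_natl mulr2n lerD2r.
by rewrite powRM// ler_wpM2l ?powR_ge0// lerDr powR_ge0.
Qed.

(** A substitute for Hölder's inequality: used pointwise on a set of finite measure, it bounds an
    L^1 norm by the measure of the set plus the integral of the [q]-th power. *)
Lemma le_onepluspowR (R : realType) (q t : R) : 1 <= q -> 0 <= t ->
  t <= 1 + t `^ q.
Proof.
move=> q1 t0; have [t1|/ltW t1] := leP t 1.
  by rewrite (le_trans t1)// lerDl powR_ge0.
by rewrite (le_trans (le1r_powR t1 q1))// lerDr.
Qed.

Section complex_modulus.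
Context {R : realType}.
Implicit Types z w : R[i].

Lemma cabs_ge0 z : 0 <= cabs z.
Proof. by case: z => x y; exact: sqrtr_ge0. Qed.

Lemma cabs_real (x : R) : cabs x%:C = `|x|.
Proof. by rewrite /cabs /= expr0n addr0 sqrtr_sqr. Qed.

Lemma normr_Re_le z : `|complex.Re z| <= cabs z.
Proof.
by case: z => x y; rewrite -sqrtr_sqr ler_wsqrtr// lerDl sqr_ge0.
Qed.

Lemma normr_Im_le z : `|complex.Im z| <= cabs z.
Proof.
by case: z => x y; rewrite -sqrtr_sqr ler_wsqrtr// lerDr sqr_ge0.
Qed.

Lemma cabs_le z : cabs z <= `|complex.Re z| + `|complex.Im z|.
Proof.
case: z => x y; rewrite -[leRHS]ger0_norm ?addr_ge0// -sqrtr_sqr ler_wsqrtr//=.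
rewrite sqrrD !real_normK ?num_real// -addrA lerD2l lerDr.
by rewrite mulrn_wge0// mulr_ge0.
Qed.

Lemma cabsD z w : cabs (z + w) <= cabs z + cabs w.
Proof. exact: le_normcD. Qed.

Lemma cabsM z w : cabs (z * w) = cabs z * cabs w.
Proof. exact: Normc.normcM. Qed.

Lemma cabsN z : cabs (- z) = cabs z.
Proof. exact: normcN. Qed.

Lemma ReD z w : complex.Re (z + w) = complex.Re z + complex.Re w.
Proof. by case: z w => ? ? [? ?]. Qed.

Lemma ImD z w : complex.Im (z + w) = complex.Im z + complex.Im w.
Proof. by case: z w => ? ? [? ?]. Qed.

Lemma ReM z w : complex.Re (z * w) =
  complex.Re z * complex.Re w - complex.Im z * complex.Im w.
Proof. by case: z w => ? ? [? ?]. Qed.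

Lemma ImM z w : complex.Im (z * w) =
  complex.Re z * complex.Im w + complex.Im z * complex.Re w.
Proof. by case: z w => ? ? [? ?]. Qed.

Lemma complexRI z : z = (complex.Re z)%:C + 'i * (complex.Im z)%:C.
Proof. exact: complexE. Qed.

End complex_modulus.

Section complex_measurable.
Context {R : realType} {d : measure_display} {M : measurableType d}.
Implicit Types f g : M -> R[i].

Lemma cmeasurable_cabs f : cmeasurable f -> measurable_fun setT (cabs \o f).
Proof.
move=> [mR mI]; rewrite (_ : cabs \o f = (fun x =>
    Num.sqrt (complex.Re (f x) ^+ 2 + complex.Im (f x) ^+ 2))); last first.
  by apply/funext => x /=; case: (f x).
apply: (measurableT_comp (continuous_measurable_fun (@sqrt_continuous R))).
by apply: measurable_funD; exact: measurable_funX.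
Qed.

Lemma cmeasurable_real (f : M -> R) : measurable_fun setT f ->
  cmeasurable (fun x => (f x)%:C).
Proof. by []. Qed.

Lemma cmeasurable_lin (c : R[i]) f g : cmeasurable f -> cmeasurable g ->
  cmeasurable (fun x => c * f x + g x).
Proof.
move=> [fR fI] [gR gI]; split.
- under eq_fun do rewrite ReD ReM; apply: measurable_funD => //.
  by apply: measurable_funB; exact: measurable_funM.
- under eq_fun do rewrite ImD ImM; apply: measurable_funD => //.
  by apply: measurable_funD; exact: measurable_funM.
Qed.

Variable mu : {measure set M -> \bar R}.

Lemma cLnormE (p : R) f : cLnorm mu p%:E f =
  ((\int[mu]_x (cabs (f x) `^ p)%:E) `^ p^-1)%E.
Proof.
rewrite /cLnorm unlock.
apply: (congr1 (fun z : \bar R => (z `^ p^-1)%E)); apply: eq_integral => x _ /=.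
by rewrite ger0_norm ?cabs_ge0.
Qed.

Lemma cLnorm1E f : cLnorm mu 1 f = (\int[mu]_x (cabs (f x))%:E)%E.
Proof.
rewrite /cLnorm Lnorm1; apply: eq_integral => x _ /=.
by rewrite ger0_norm ?cabs_ge0.
Qed.

Lemma cLpP (p : R) f : 0 < p -> cLp mu p%:E f <->
  cmeasurable f /\ (\int[mu]_x (cabs (f x) `^ p)%:E < +oo)%E.
Proof.
move=> p0; split => -[mf foo]; split => //; move: foo; rewrite cLnormE.
  by apply: lty_poweRy; rewrite invr_neq0// gt_eqF.
exact: poweR_lty.
Qed.

Lemma measurable_powR_norm (q : R) (f : M -> R) : measurable_fun setT f ->
  measurable_fun setT (fun x => (`|f x| `^ q)%:E).
Proof.
move=> mf; apply/measurable_EFinP.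
by apply: (measurableT_comp (measurable_powR q)); exact: measurableT_comp.
Qed.

End complex_measurable.

(** * Atoms and L^q functions supported in balls *)

Section balls.
Context {R : realType} {d : measure_display} {M : measurableType d}.
Context {rho : M -> M -> R} {mu : {measure set M -> \bar R}}.
Hypothesis hM : homogeneous_type rho mu.
Implicit Types (x : M) (r : R).

Lemma measurable_closed_qball x r : measurable (closed_qball rho x r).
Proof.
rewrite (_ : closed_qball rho x r = \bigcap_n qball rho x (r + n.+1%:R^-1)).
  by apply: bigcap_measurable => // n _; exact: ht_measurable_ball hM _ _.
apply/seteqP; split => y /=.
  by move=> yr n _ /=; rewrite /qball/= (le_lt_trans yr)// ltrDl.
move=> yr; rewrite /closed_qball/=; apply/ler_addgt0Pr => e e0.
near \oo => n; apply/ltW/(lt_trans (yr n I)); rewrite ltrD2l.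
by near: n; exact: near_infty_natSinv_lt (PosNum e0).
Unshelve. all: by end_near. Qed.

Lemma closed_qball_measure x r : 0 < r ->
  exists2 m : R, 0 < m & mu (closed_qball rho x r) = m%:E.
Proof.
move=> r0; have mb := @measurable_closed_qball x r.
have p : (0 < mu (closed_qball rho x r))%E.
  apply: (lt_le_trans (ht_ball_gt0 hM x r0)).
  apply: le_measure; rewrite ?inE//; first exact: ht_measurable_ball hM _ _.
  by move=> y; exact: ltW.
have : (mu (closed_qball rho x r) < +oo)%E.
  have r2 : 0 < 2 * r by rewrite mulr_gt0.
  apply: le_lt_trans (ht_ball_fin hM x r2).
  apply: le_measure; rewrite ?inE//; first exact: ht_measurable_ball hM _ _.
  by move=> y; move=> yr; apply: (le_lt_trans yr); rewrite ltr_pMl// ltr1n.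
by move: p; case: (mu _) => // m m0 _; exists m.
Qed.

Lemma closed_qball_sub x0 x r : exists n : nat,
  closed_qball rho x r `<=` qball rho x0 n%:R.
Proof.
have [K hK] := qm_triangle (ht_quasi_metric hM).
exists (Num.truncn (`|K| * (rho x0 x + `|r|))).+1 => y; rewrite /closed_qball/= => yr.
apply: le_lt_trans (truncnS_gt _).
apply: (le_trans (hK x0 y x)); apply: (le_trans (ler_norm _)).
rewrite normrM ler_wpM2l// ger0_norm.
  by rewrite lerD2l (le_trans yr)// ler_norm.
by rewrite addr_ge0//; exact: qm_ge0 (ht_quasi_metric hM) _ _.
Qed.

End balls.

Section atoms.
Context {R : realType} {d : measure_display} {M : measurableType d}.
Context {rho : M -> M -> R} {mu : {measure set M -> \bar R}}.
Hypothesis hM : homogeneous_type rho mu.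
Context {q : R}.
Hypothesis q_gt1 : 1 < q.

Let q_gt0 : 0 < q. Proof. exact: lt_trans q_gt1. Qed.

Lemma atom_normalization (m : R) (I : \bar R) : 0 < m -> (0 <= I)%E ->
  ((((m%:E)^-1 * I) `^ q^-1 <= (m%:E)^-1)%E <-> (I <= (m `^ (1 - q))%:E)%E).
Proof.
move=> m0; have m1 : m^-1 >= 0 by rewrite invr_ge0 ltW.
rewrite inver gt_eqF//; case: I => [t| |]// t0.
- rewrite lee_fin in t0.
  rewrite -EFinM poweR_EFin !lee_fin; have mt : 0 <= m^-1 * t by exact: mulr_ge0.
  have -> : m `^ (1 - q) = m * m^-1 `^ q.
    rewrite powRB ?powRr1 ?ltW//; last by rewrite (gt_eqF m0) implybT.
    by rewrite -(powR_inv1 (ltW m0)) -powRrM mulN1r powRN.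
  rewrite -ler_pdivrMl//.
  split => [h|h].
    have := ge0_ler_powR (ltW q_gt0) (powR_ge0 _ _) m1 h.
    by rewrite -powRrM mulVf ?gt_eqF// powRr1.
  have q1 : 0 <= q^-1 by rewrite invr_ge0 ltW.
  have := ge0_ler_powR q1 mt (powR_ge0 _ _) h.
  by rewrite -powRrM mulfV ?gt_eqF// powRr1.
- by rewrite gt0_muley ?lte_fin ?invr_gt0//= gt_eqF ?invr_gt0.
Qed.

(** The form in which atoms are used from here on. The integral may run over all of [M] because [a]
    vanishes a.e. off the ball, and membership in L^q is a consequence of the bound. *)
Lemma atomP (a : M -> R[i]) : atom rho mu q a <-> exists x r, 0 < r /\
  [/\ cmeasurable a, {ae mu, forall y, ~ closed_qball rho x r y -> a y = 0},
    cintegral mu a = 0 &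
    (\int[mu]_y (cabs (a y) `^ q)%:E <=
      (fine (mu (closed_qball rho x r)) `^ (1 - q))%:E)%E].
Proof.
have key x r : 0 < r -> cmeasurable a ->
    {ae mu, forall y, ~ closed_qball rho x r y -> a y = 0} ->
  ((((mu (closed_qball rho x r))^-1 *
     \int[mu]_(x in closed_qball rho x r) ((cabs (a x)) `^ q)%:E) `^ q^-1
        <= (mu (closed_qball rho x r))^-1)%E <->
   (\int[mu]_y (cabs (a y) `^ q)%:E <=
      (fine (mu (closed_qball rho x r)) `^ (1 - q))%:E)%E).
  move=> r0 ma aB; have [m m0 mE] := closed_qball_measure hM x r0.
  have mb := measurable_closed_qball hM x r.
  have mc : measurable_fun setT (fun y => (cabs (a y) `^ q)%:E).
    apply/measurable_EFinP; apply: (measurableT_comp (measurable_powR q)).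
    exact: cmeasurable_cabs.
  have -> : (\int[mu]_(x in closed_qball rho x r) (cabs (a x) `^ q)%:E =
      \int[mu]_y (cabs (a y) `^ q)%:E)%E.
    rewrite integral_mkcond; apply: ge0_ae_eq_integral => //.
    - by apply/(measurable_restrictT _ _).1 => //; exact: measurable_funTS.
    - by move=> y _; apply: erestrict_ge0 => z _; rewrite lee_fin powR_ge0.
    - by move=> y _; rewrite lee_fin powR_ge0.
    - apply: filterS aB => y /= ay _; rewrite /patch; case: ifPn => // yB.
      rewrite ay; last by move/mem_set; exact/negP.
      by rewrite cabs_real normr0 powR0 ?gt_eqF.
  rewrite mE /=; apply: atom_normalization => //.
  by apply: integral_ge0 => y _; rewrite lee_fin powR_ge0.
split => -[x [r [r0 [h1 h2 h3 h4]]]]; exists x, r; split => //.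
  have [ma _] := h1.
  by split => //; apply/(key x r).
split => //; last exact/(key x r).
by apply/cLpP => //; split => //; apply: le_lt_trans h4 _; rewrite ltry.
Qed.

Lemma atom_real (a : M -> R) x r : 0 < r -> measurable_fun setT a ->
  (forall y, ~ closed_qball rho x r y -> a y = 0) -> \int[mu]_y a y = 0 ->
  (\int[mu]_y (`|a y| `^ q)%:E <=
      (fine (mu (closed_qball rho x r)) `^ (1 - q))%:E)%E ->
  atom rho mu q (fun y => (a y)%:C).
Proof.
move=> r0 ma aB a0 aq; apply/atomP; exists x, r; split; [exact: r0 | split].
- exact: cmeasurable_real.
- by apply: aeW => y /aB ->.
- by rewrite /cintegral/= a0 Rintegral_cst// mul0r.
- by under eq_integral do rewrite cabs_real.
Qed.

Variable x0 : M.
Implicit Types f g : M -> R.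

Let B n := qball rho x0 n%:R.

Let mB n : measurable (B n).
Proof. exact: ht_measurable_ball hM _ _. Qed.

Let ndB n m x : (n <= m)%N -> B n x -> B m x.
Proof. by move=> nm /lt_le_trans; apply; rewrite ler_nat. Qed.

Let Bfin n : (mu (B n) < +oo)%E.
Proof.
apply: (@le_lt_trans _ _ (mu (B n.+1))); last exact: (ht_ball_fin hM x0 (ltr0Sn R n)).
by apply: le_measure; rewrite ?inE// => x; exact: ndB.
Qed.

(** The support condition holds at every point, not just a.e. as for atoms; [riesz_representation]
    asks for it in this form. The balls about the single centre [x0] exhaust [M]. *)
Definition Lq_bounded_support : set (M -> R) := [set f : M -> R |
  [/\ measurable_fun setT f,
      exists n : nat, forall x, ~ qball rho x0 n%:R x -> f x = 0 &
      (\int[mu]_x (`|f x| `^ q)%:E < +oo)%E]].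

Definition Lq0_bounded_support : set (M -> R) := [set f : M -> R |
  Lq_bounded_support f /\ \int[mu]_x f x = 0].

Let W := Lq_bounded_support.
Let V := Lq0_bounded_support.

Lemma Lq_solid f g : W g -> measurable_fun setT f ->
  (forall x, `|f x| <= `|g x|) -> W f.
Proof.
move=> [mg [n gn] gq] mf fg; split; first exact: mf.
  exists n => x /gn gx; apply/eqP; rewrite -normr_le0.
  by rewrite (le_trans (fg x))// gx normr0.
apply: le_lt_trans gq; apply: ge0_le_integral => //.
- exact: measurable_powR_norm.
- exact: measurable_powR_norm.
- by move=> x _; rewrite lee_fin ge0_ler_powR ?nnegrE// ltW.
Qed.

Lemma integral_powR_lin (c : R) f g : measurable_fun setT f ->
  measurable_fun setT g ->
  (\int[mu]_x (`|c * f x + g x| `^ q)%:E <= (2 `^ q)%:E *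
   ((`|c| `^ q)%:E * \int[mu]_x (`|f x| `^ q)%:E + \int[mu]_x (`|g x| `^ q)%:E))%E.
Proof.
move=> mf mg.
have m1 := measurable_powR_norm q mf; have m2 := measurable_powR_norm q mg.
rewrite -ge0_integralZl//.
have mcf : measurable_fun setT (fun x => (`|c| `^ q)%:E * (`|f x| `^ q)%:E)%E.
  exact: measurable_funeM.
rewrite -ge0_integralD//.
rewrite -ge0_integralZl//; last 2 first.
- exact: emeasurable_funD.
- by move=> *; rewrite adde_ge0 ?mule_ge0 ?lee_fin.
apply: ge0_le_integral => //.
- apply: (@measurable_powR_norm _ _ _ q (fun x => c * f x + g x)).
  by apply: measurable_funD => //; exact: measurable_funM.
- apply: measurable_funeM; apply: emeasurable_funD => //; exact: measurable_funeM.
- move=> x _; suff : `|c * f x + g x| `^ q <=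
      2 `^ q * (`|c| `^ q * `|f x| `^ q + `|g x| `^ q) by rewrite -lee_fin.
  apply: (@le_trans _ _ ((`|c| * `|f x| + `|g x|) `^ q)).
    rewrite ge0_ler_powR ?nnegrE ?addr_ge0 ?mulr_ge0// ?(ltW q_gt0)//.
    by rewrite -normrM ler_normD.
  rewrite -powRM//; apply: powRD_le; rewrite ?mulr_ge0//.
  exact: ltW.
Qed.

Lemma Lq_linear (c : R) f g : W f -> W g -> W (fun x => c * f x + g x).
Proof.
move=> [mf [n fn] fq] [mg [k gk] gq]; split.
- by apply: measurable_funD => //; exact: measurable_funM.
- exists (maxn n k) => x Bx; rewrite fn ?gk ?mulr0 ?addr0//.
    by apply: contra_not Bx; apply: ndB; exact: leq_maxr.
  by apply: contra_not Bx; apply: ndB; exact: leq_maxl.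
- apply: (le_lt_trans (integral_powR_lin _ mf mg)).
  rewrite lte_mul_pinfty ?lee_fin ?powR_ge0//.
  apply: lte_add_pinfty gq.
  by apply: (lte_mul_pinfty _ _ fq); rewrite // lee_fin powR_ge0.
Qed.

Lemma Lq_indic n E : measurable E -> E `<=` qball rho x0 n%:R -> W (\1_E).
Proof.
move=> mE EB; split; first exact: measurable_indic.
  by exists n => x Bx; rewrite indicE memNset// => /EB.
rewrite (eq_integral (fun x => (\1_E x)%:E)); last first.
  move=> x _; rewrite indicE normr_nat; case: (_ \in _); rewrite ?powR1//.
  by rewrite powR0// gt_eqF.
rewrite integral_indic// setIT; apply: le_lt_trans (Bfin n).
by apply: le_measure; rewrite ?inE.
Qed.

Lemma integral_norm_le n f : measurable_fun setT f ->
  (forall x, ~ qball rho x0 n%:R x -> f x = 0) ->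
  (\int[mu]_x `|f x|%:E <= mu (qball rho x0 n%:R) + \int[mu]_x (`|f x| `^ q)%:E)%E.
Proof.
move=> mf fn; have mq := measurable_powR_norm q mf.
rewrite -[X in (_ <= mu X + _)%E]setIT -integral_indic//; last exact: (mB n).
have mi : measurable_fun setT (fun x => (\1_(B n) x)%:E : \bar R).
  by apply/measurable_EFinP; exact: measurable_indic.
rewrite -ge0_integralD//.
apply: ge0_le_integral => //.
- by apply/measurable_EFinP; exact: measurableT_comp.
- exact: emeasurable_funD.
- move=> x _; rewrite -EFinD lee_fin indicE.
  case: (boolP (x \in B n)) => xB; first exact: le_onepluspowR (ltW q_gt1) _.
  by rewrite fn ?normr0 ?addr_ge0 ?powR_ge0// => /mem_set; exact/negP.
Qed.

Lemma Lq_integrable f : W f -> mu.-integrable setT (EFin \o f).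
Proof.
move=> [mf [n fn] fq]; apply/integrableP; split; first exact/measurable_EFinP.
apply: (le_lt_trans (integral_norm_le mf fn)).
by rewrite lte_add_pinfty//; exact: Bfin.
Qed.

Lemma Lq0_linear (c : R) f g : V f -> V g -> V (fun x => c * f x + g x).
Proof.
move=> [Wf f0] [Wg g0]; split; first exact: (Lq_linear c Wf Wg).
have fi := Lq_integrable Wf; have gi := Lq_integrable Wg.
rewrite (RintegralD measurableT (integrableZl measurableT c fi) gi).
by rewrite (RintegralZl c measurableT fi) f0 g0 mulr0 addr0.
Qed.

Lemma Lq0_atom (c Q : R) f x r : 0 < r -> 0 < c -> measurable_fun setT f ->
  (forall y, ~ closed_qball rho x r y -> f y = 0) -> \int[mu]_y f y = 0 ->
  mu.-integrable setT (EFin \o f) ->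
  (\int[mu]_y (`|f y| `^ q)%:E <= Q%:E)%E ->
  Q <= c `^ q * fine (mu (closed_qball rho x r)) `^ (1 - q) ->
  atom rho mu q (fun y => (c^-1 * f y)%:C).
Proof.
move=> r0 c0 mf fB f0 fi fQ Qc; apply: (@atom_real _ x r) => //.
- exact: measurable_funM.
- by move=> y /fB ->; rewrite mulr0.
- by rewrite RintegralZl// f0 mulr0.
- rewrite (eq_integral (fun y => ((c^-1 `^ q)%:E * (`|f y| `^ q)%:E)%E)); last first.
    move=> y _; rewrite normrM powRM// ger0_norm ?EFinM//.
    by rewrite invr_ge0 ltW.
  have mq := measurable_powR_norm q mf.
  rewrite ge0_integralZl ?lee_fin ?powR_ge0//.
  apply: (@le_trans _ _ ((c^-1 `^ q)%:E * Q%:E)%E).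
    by apply: lee_wpmul2l => //; rewrite lee_fin powR_ge0.
  rewrite -EFinM lee_fin -(ler_pM2l (powR_gt0 q c0)) mulrA -powRM ?invr_ge0 ?(ltW c0)//.
  by rewrite divff ?gt_eqF// powR1 mul1r.
Qed.

(** The constant depends on the ball and on [Q] but not on [f]. This uniformity is what converts a
    bound on atoms into a bound on norm balls of L^q functions with a common support. *)
Lemma Lq0_uniform_atom (n : nat) (Q : R) : exists2 c : R, 0 < c &
  forall f, V f -> (forall x, ~ qball rho x0 n%:R x -> f x = 0) ->
    (\int[mu]_x (`|f x| `^ q)%:E <= Q%:E)%E ->
    atom rho mu q (fun y => (c^-1 * f y)%:C).
Proof.
have [m m0 mE] := closed_qball_measure hM x0 (ltr0Sn R n).
have mq0 : 0 < m `^ (1 - q) by exact: powR_gt0.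
(* A constant [c >= 1] satisfies [c <= c]^ q[, so it is enough that]Q <= c * m [^ (1 - q)], and no
   root has to be taken. The ball has radius [n.+1] to keep it positive when [n] is 0. *)
exists (Num.max 1 (Q / m `^ (1 - q))).
  by rewrite lt_max ltr01.
move=> f [Wf f0] fn fQ; apply: (@Lq0_atom _ Q _ x0 n.+1%:R) => //.
- by rewrite lt_max ltr01.
- by case: Wf.
- move=> y yB; apply: fn; apply: contra_not yB => yB.
  by rewrite /closed_qball/=; apply/ltW/(lt_trans yB); rewrite ltr_nat.
- exact: Lq_integrable.
- rewrite mE /= -ler_pdivrMr//.
  rewrite (le_trans _ (le1r_powR _ (ltW q_gt1)))// le_max ?lexx//.
  by rewrite orbT.
Qed.

Lemma Lq0_multiple_of_atom f : V f -> exists2 c : R, 0 < c &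
  atom rho mu q (fun y => (c^-1 * f y)%:C).
Proof.
move=> Vf; have [[mf [n fn] fq] _] := Vf.
have [c c0 hc] := Lq0_uniform_atom n (fine (\int[mu]_x (`|f x| `^ q)%:E)).
exists c => //; apply: hc => //; rewrite fineK// ge0_fin_numE//.
by apply: integral_ge0 => x _; rewrite lee_fin powR_ge0.
Qed.

Lemma cL1P (f : M -> R[i]) : cLp mu 1%:E f <->
  mu.-integrable setT (fun x => (complex.Re (f x))%:E) /\
  mu.-integrable setT (fun x => (complex.Im (f x))%:E).
Proof.
have mE (g : M -> R) : measurable_fun setT (fun x => (g x)%:E : \bar R) <->
  measurable_fun setT g by split => /measurable_EFinP.
split=> [[[mR mI]]|[/integrableP[/mE mR fR] /integrableP[/mE mI fI]]].
  have mc := cmeasurable_cabs (conj mR mI); rewrite cLnorm1E => fy.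
  by split; apply/integrableP; split; try exact/mE;
    apply: le_lt_trans fy; apply: ge0_le_integral => //;
    try (by apply/mE; do ?exact: measurableT_comp);
    move=> x _; rewrite lee_fin ?normr_Re_le ?normr_Im_le.
have mc := cmeasurable_cabs (conj mR mI).
split => //; rewrite cLnorm1E.
apply: le_lt_trans (lte_add_pinfty fR fI).
have m1 : measurable_fun setT (fun x => `|complex.Re (f x)|%:E : \bar R).
  by apply/mE; exact: measurableT_comp.
have m2 : measurable_fun setT (fun x => `|complex.Im (f x)|%:E : \bar R).
  by apply/mE; exact: measurableT_comp.
rewrite -ge0_integralD//; apply: ge0_le_integral => //.
- by move=> x _; rewrite lee_fin cabs_ge0.
- exact/mE.
- exact: emeasurable_funD.
- by move=> x _; rewrite -EFinD lee_fin cabs_le.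
Qed.

(** Both parts are bounded by [cabs a], so they satisfy the size condition for the same ball.
    Multiplying by the indicator of that ball changes them on a null set only and gives the
    pointwise support condition of [V]. *)
Lemma atom_Re_Im (a : M -> R[i]) : atom rho mu q a -> exists a1 a2 : M -> R,
  [/\ V a1, V a2, atom rho mu q (fun y => (a1 y)%:C),
      atom rho mu q (fun y => (a2 y)%:C) &
      a = (fun y => (a1 y)%:C + 'i * (a2 y)%:C) %[ae mu]].
Proof.
move/atomP => [x [r [r0 [ma aB a0 aq]]]].
have [n Bn] := closed_qball_sub hM x0 x r.
have mB' := measurable_closed_qball hM x r.
set B' := closed_qball rho x r in aB aq Bn mB'.
have part (p : R[i] -> R) : p 0 = 0 -> (forall z, `|p z| <= cabs z) ->
    measurable_fun setT (fun y => p (a y)) -> \int[mu]_y p (a y) = 0 ->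
    let b y := p (a y) * \1_B' y in
    [/\ V b, atom rho mu q (fun y => (b y)%:C) & {ae mu, forall y, b y = p (a y)}].
  move=> p0 pc mp ip0 b.
  have mb : measurable_fun setT b.
    by apply: measurable_funM => //; exact: measurable_indic.
  have bae : {ae mu, forall y, b y = p (a y)}.
    apply: filterS aB => y; rewrite /b indicE.
    by case: (boolP (y \in B')) => [_ _|yB -> //]; rewrite ?mulr1 ?p0 ?mul0r//;
      move/mem_set; exact/negP.
  have bB y : ~ B' y -> b y = 0 by move=> By; rewrite /b indicE memNset ?mulr0.
  have b0 : \int[mu]_y b y = 0.
    rewrite -ip0 /Rintegral; congr fine; apply: ae_eq_integral => //.
    - exact/measurable_EFinP.
    - exact/measurable_EFinP.
    - by apply: filterS bae => y -> _.
  have bq : (\int[mu]_y (`|b y| `^ q)%:E <=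
      (fine (mu (closed_qball rho x r)) `^ (1 - q))%:E)%E.
    apply: le_trans aq; apply: ge0_le_integral => //.
    - exact: measurable_powR_norm.
    - apply/measurable_EFinP; apply: (measurableT_comp (measurable_powR q)).
      exact: cmeasurable_cabs.
    - move=> y _; rewrite lee_fin ge0_ler_powR ?nnegrE ?cabs_ge0 ?(ltW q_gt0)//.
      apply: le_trans (pc _); rewrite /b indicE.
      by case: (_ \in _); rewrite ?mulr1 ?mulr0 ?normr0.
  split=> //; last exact: (@atom_real _ x r).
  split => //; split => //; last by apply: le_lt_trans bq _; rewrite ltry.
  by exists n => y yB; apply: bB; apply: contra_not yB; exact: Bn.
have [mR mI] := ma.
have [aR aI] : \int[mu]_y complex.Re (a y) = 0 /\ \int[mu]_y complex.Im (a y) = 0.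
  by case: a0.
have [V1 A1 e1] := part (@complex.Re R) erefl (@normr_Re_le R) mR aR.
have [V2 A2 e2] := part (@complex.Im R) erefl (@normr_Im_le R) mI aI.
exists (fun y => complex.Re (a y) * \1_B' y), (fun y => complex.Im (a y) * \1_B' y).
split => //; apply: filterS2 e1 e2 => y -> -> _; exact: complexRI.
Qed.

(** Every mean zero L^q function with bounded support is a multiple of one atom, so finite
    combinations of atoms form, up to null sets, the complexification of [V]. This frees the later
    arguments from any choice of a finite decomposition. *)
Lemma HfinP (g : M -> R[i]) : Hfin rho mu q g <-> cLp mu 1%:E g /\
  exists f1 f2 : M -> R, [/\ V f1, V f2 &
    g = (fun y => (f1 y)%:C + 'i * (f2 y)%:C) %[ae mu]].
Proof.
split => -[gL].
  move=> [n [lam [a [ha ga]]]]; split => //.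
  suff [f1 [f2 [V1 V2 e]]] : exists f1 f2 : M -> R, [/\ V f1, V f2 &
      (fun x => \sum_(j < n) lam j * a j x) =
      (fun y => (f1 y)%:C + 'i * (f2 y)%:C) %[ae mu]].
    exists f1, f2; split => //; apply: filterS2 ga e => y /(_ I) -> /(_ I) -> //.
  elim: n lam a ha {ga} => [|n ih] lam a ha.
    have V0 : V (cst 0).
      split; last by rewrite Rintegral_cst// mul0r.
      by apply: (@Lq_solid _ (\1_(B 0))) => [|//|x]; [exact: (@Lq_indic 0) | rewrite normr0].
    exists (cst 0), (cst 0); split => //.
    by apply: aeW => x _; rewrite big_ord0 mulr0 addr0.
  have [f1 [f2 [V1 V2 e]]] := ih (fun j => lam (lift ord0 j)) (fun j => a (lift ord0 j))
    (fun j => ha (lift ord0 j)).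
  have [a1 [a2 [U1 U2 _ _ e']]] := atom_Re_Im (ha ord0).
  exists (fun y => complex.Re (lam ord0) * a1 y + (- complex.Im (lam ord0) * a2 y + f1 y)).
  exists (fun y => complex.Re (lam ord0) * a2 y + (complex.Im (lam ord0) * a1 y + f2 y)).
  split; [by apply: Lq0_linear => //; exact: Lq0_linear|
    by apply: Lq0_linear => //; exact: Lq0_linear|].
  apply: filterS2 e e' => y /(_ I) e /(_ I) e' _.
  rewrite big_ord_recl e e' {1}(complexRI (lam ord0)).
  by apply/eqP; rewrite eq_complex !(ReD, ImD, ReM, ImM)/=; apply/andP; split;
    apply/eqP; ring.
move=> [f1 [f2 [V1 V2 e]]]; split => //.
have [c1 c10 A1] := Lq0_multiple_of_atom V1.
have [c2 c20 A2] := Lq0_multiple_of_atom V2.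
exists 2%N, (fun j => if j == ord0 then c1%:C else 'i * c2%:C).
exists (fun j y => if j == ord0 then (c1^-1 * f1 y)%:C else (c2^-1 * f2 y)%:C).
split; first by move=> j; case: (j == ord0).
apply: filterS e => y /(_ I) -> _.
rewrite big_ord_recl big_ord1 /=.
by rewrite -mulrA -!rmorphM/= !mulrA !mulfV ?gt_eqF// !mul1r.
Qed.

End atoms.

Lemma measurable_fun_sgr (R : realType) (d : measure_display)
    (M : measurableType d) (f : M -> R) :
  measurable_fun setT f -> measurable_fun setT (fun x => Num.sg (f x)).
Proof.
move=> mf; rewrite (_ : (fun x => _) =
    (fun x => \1_(f @^-1` `]0, +oo[) x - \1_(f @^-1` `]-oo, 0[) x)).
  by apply: measurable_funB; apply: measurable_indic; rewrite -[X in measurable X]setTI;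
    apply: mf => //; exact: measurable_itv.
apply/funext => x; have preE (S : set R) : (x \in f @^-1` S) = (f x \in S).
  by apply/idP/idP => /set_mem h; exact/mem_set.
rewrite !indicE !preE !mem_setE !in_itv/= andbT.
case: (ltgtP (f x) 0) => [y0|y0|->] /=.
- by rewrite ltr0_sg// sub0r.
- by rewrite gtr0_sg// subr0.
- by rewrite sgr0 subr0.
Qed.

(** * Functionals bounded on atoms *)

Section atom_bounded_functional.
Context {R : realType} {d : measure_display} {M : measurableType d}.
Context {rho : M -> M -> R} {mu : {measure set M -> \bar R}}.
Hypothesis hM : homogeneous_type rho mu.
Hypothesis mu_sfin : sigma_finite setT mu.
Context {q : R}.
Hypothesis q_gt1 : 1 < q.
Variable x0 : M.

Local Notation W := (@Lq_bounded_support R d M rho mu q x0).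
Local Notation V := (@Lq0_bounded_support R d M rho mu q x0).
Local Notation B := (fun n : nat => qball rho x0 n%:R).
Local Notation "'I f" := (\int[mu]_x f x) (at level 10, f at level 8).

Variables (u : (M -> R) -> R) (A : R).
Hypothesis A_gt0 : 0 < A.
Hypothesis u_linear : forall (c : R) (f g : M -> R), V f -> V g ->
  u (fun x => c * f x + g x) = c * u f + u g.
Hypothesis u_ae : forall f g : M -> R, V f -> V g ->
  {ae mu, forall x, f x = g x} -> u f = u g.
Hypothesis u_atom : forall a : M -> R, V a ->
  atom rho mu q (fun y => (a y)%:C) -> `|u a| <= A.

Let q_gt0 : 0 < q. Proof. exact: lt_trans q_gt1. Qed.

Let mB n : measurable (B n).
Proof. exact: ht_measurable_ball hM _ _. Qed.

Let e0 x : R := (fine (mu (B 1%N)))^-1 * \1_(B 1%N) x.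

Let muB1 : exists2 m : R, 0 < m & mu (B 1%N) = m%:E.
Proof.
have := ht_ball_gt0 hM x0 (@ltr01 R); have := ht_ball_fin hM x0 (@ltr01 R).
by case: (mu _) => // m _ m0; exists m.
Qed.

Let WB n : W (\1_(B n)).
Proof. by apply: (@Lq_indic _ _ _ _ _ hM _ q_gt1 _ n) => //; exact: mB. Qed.

Let W0 : W (cst 0).
Proof.
apply: (@Lq_solid _ _ _ _ _ _ q_gt1 _ _ (\1_(B 0%N))) => //.
by move=> x; rewrite normr0.
Qed.

Let W_scale (c : R) f : W f -> W (fun x => c * f x).
Proof.
move=> Wf; have := Lq_linear q_gt1 c Wf W0.
by under [X in W X -> _]funext do rewrite addr0.
Qed.

Let We0 : W e0.
Proof. by apply: W_scale; exact: (WB 1%N). Qed.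

Let e0_supp x : ~ B 1%N x -> e0 x = 0.
Proof. by move=> Bx; rewrite /e0 indicE memNset ?mulr0. Qed.

Let integral_lin (c : R) f g : W f -> W g ->
  \int[mu]_x (c * f x + g x) = c * 'I f + 'I g.
Proof.
move=> Wf Wg; have fi := Lq_integrable hM q_gt1 Wf.
have gi := Lq_integrable hM q_gt1 Wg.
rewrite RintegralD//; last exact: (integrableZl measurableT c fi).
by rewrite RintegralZl.
Qed.

Let Ie0 : 'I e0 = 1.
Proof.
have [m m0 mE] := muB1; rewrite /e0 mE /= RintegralZl//; last first.
  exact: (Lq_integrable hM q_gt1 (WB 1)).
rewrite /Rintegral integral_indic// setIT mE /= mulVf// gt_eqF//.
Qed.

(** [riesz_representation] needs a solid space, and the mean zero condition is not stable under
    cutting functions down. Since [e0] has integral 1, [P] projects [W] onto [V], and [u] composed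
    with [P] extends [u] to the solid space [W]. *)
Let P f x := - 'I f * e0 x + f x.

Let WP f : W f -> W (P f).
Proof. by move=> Wf; apply: Lq_linear. Qed.

Let VP f : W f -> V (P f).
Proof.
move=> Wf; split; first exact: WP.
by rewrite integral_lin// Ie0 mulr1 addNr.
Qed.

Let v f := u (P f).

Let v_linear (c : R) f g : W f -> W g ->
  v (fun x => c * f x + g x) = c * v f + v g.
Proof.
move=> Wf Wg; rewrite /v -u_linear; [|exact: VP|exact: VP].
by congr u; apply/funext => x; rewrite /P integral_lin//; ring.
Qed.

Let vE f : V f -> v f = u f.
Proof.
move=> [Wf f0]; congr u; apply/funext => x.
by rewrite /P f0 oppr0 mul0r add0r.
Qed.

Let v0 : v (cst 0) = 0.
Proof.
have := v_linear (-1) W0 W0; rewrite mulN1r addNr.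
suff -> : (fun x : M => -1 * cst 0 x + cst 0 x) = cst 0 :> (M -> R) by [].
by apply/funext => x /=; rewrite mulr0 addr0.
Qed.

Let v_scale (c : R) f : W f -> v (fun x => c * f x) = c * v f.
Proof.
move=> Wf; rewrite -[RHS]addr0 -v0 -v_linear//.
by congr v; apply/funext => x; rewrite addr0.
Qed.

Let v_null f : W f -> {ae mu, forall x, f x = 0} -> v f = 0.
Proof.
move=> Wf f0; rewrite -v0; apply: u_ae; [exact: VP|exact: VP|].
have e : 'I f = 'I (cst 0 : M -> R).
  rewrite /Rintegral; congr fine; apply: ae_eq_integral => //.
  - by apply/measurable_EFinP; case: Wf.
  - exact/measurable_EFinP.
  - by apply: filterS f0 => x -> _.
by apply: filterS f0 => x fx; rewrite /P e fx.
Qed.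

(** [P f] lives in the fixed ball [B k], which contains both [B n] and the support of [e0], and its
    [q]-th power integral is bounded uniformly in [f]; so it is a fixed multiple of an atom. *)
Let v_bounded n : exists2 C : R, 0 < C & forall f, W f ->
  (forall x, ~ B n x -> f x = 0) -> (\int[mu]_x (`|f x| `^ q)%:E <= 1)%E ->
  `|v f| <= C.
Proof.
have [k [nk k1]] : exists k : nat, B n `<=` B k /\ B 1%N `<=` B k.
  exists (maxn n 1); split => x /lt_le_trans; apply; rewrite ler_nat.
    exact: leq_maxl.
  exact: leq_maxr.
have Bn_fin : (mu (B n) < +oo)%E.
  apply: (@le_lt_trans _ _ (mu (B n.+1))); last exact: (ht_ball_fin hM x0 (ltr0Sn R n)).
  apply: le_measure; rewrite ?inE// => x /lt_le_trans; apply.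
  by rewrite ler_nat.
have [mn mnE] : exists m : R, mu (B n) = m%:E.
  by exists (fine (mu (B n))); rewrite fineK// ge0_fin_numE.
have [me meE] : exists m : R, (\int[mu]_x (`|e0 x| `^ q)%:E = m%:E)%E.
  exists (fine (\int[mu]_x (`|e0 x| `^ q)%:E)); rewrite fineK// ge0_fin_numE//.
    by case: We0.
  by apply: integral_ge0 => x _; rewrite lee_fin powR_ge0.
have me0 : 0 <= me.
  by rewrite -lee_fin -meE; apply: integral_ge0 => x _; rewrite lee_fin powR_ge0.
have mn0 : 0 <= mn by rewrite -lee_fin -mnE.
(* The bound of [integral_powR_lin] for [P f]: [mn + 1] dominates the mean of [f] by
   [integral_norm_le], [me] is the integral for [e0], and the last 1 is the one assumed for [f]. *)
pose Q := 2 `^ q * ((mn + 1) `^ q * me + 1).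
have [c c0 hc] := Lq0_uniform_atom hM q_gt1 x0 k Q.
exists (c * A); first exact: mulr_gt0.
move=> f Wf fn fq; have VPf := VP Wf; have mf : measurable_fun setT f by case: Wf.
have If : `|'I f| <= mn + 1.
  rewrite -lee_fin EFin_normr_Rintegral//; last exact: (Lq_integrable hM q_gt1 Wf).
  apply: (le_trans (le_abse_integral _ _ _)) => //; first exact/measurable_EFinP.
  apply: (le_trans (integral_norm_le hM q_gt1 mf fn)).
  by rewrite mnE EFinD leeD.
have PfQ : (\int[mu]_x (`|P f x| `^ q)%:E <= Q%:E)%E.
  apply: (le_trans (integral_powR_lin q_gt1 _ _ _)) => //.
    by case: We0.
  rewrite /Q EFinM; apply: lee_wpmul2l; first by rewrite lee_fin powR_ge0.
  rewrite EFinD leeD// meE -EFinM lee_fin ler_wpM2r//.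
  by rewrite normrN ge0_ler_powR ?nnegrE ?addr_ge0// ltW.
have Pfk x : ~ B k x -> P f x = 0.
  move=> Bx; rewrite /P fn ?e0_supp ?mulr0 ?addr0//.
    by apply: contra_not Bx => /k1.
  by apply: contra_not Bx => /nk.
have aP := hc _ VPf Pfk PfQ.
have V0 : V (cst 0) by split => //; rewrite Rintegral_cst// mul0r.
(* Linearity of [u] is stated for [c * f + g], so a pure multiple is written with [g] equal to
   zero. *)
have scaleE : (fun x => c^-1 * P f x) = (fun x => c^-1 * P f x + (cst 0) x).
  by apply/funext => x; rewrite addr0.
have := @u_atom (fun x => c^-1 * P f x); rewrite scaleE => h.
have /h/(_ aP) := Lq0_linear hM q_gt1 c^-1 VPf V0.
rewrite u_linear// -(vE V0) v0 addr0 normrM gtr0_norm ?invr_gt0//.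
by rewrite ler_pdivrMl.
Qed.

Let v_small n : exists2 C : R, 0 < C & forall (e : R) f, 0 < e -> W f ->
  (forall x, ~ B n x -> f x = 0) ->
  (\int[mu]_x (`|f x| `^ q)%:E <= (e `^ q)%:E)%E -> `|v f| <= C * e.
Proof.
have [C C0 hC] := v_bounded n; exists C => // e f e0' Wf fn fq.
have mf : measurable_fun setT f by case: Wf.
have ei : 0 < e^-1 by rewrite invr_gt0.
have := hC _ (W_scale e^-1 Wf).
rewrite v_scale// normrM gtr0_norm// ler_pdivrMl// mulrC; apply.
  by move=> x /fn ->; rewrite mulr0.
have mq := measurable_powR_norm q mf.
rewrite (eq_integral (fun x => ((e^-1 `^ q)%:E * (`|f x| `^ q)%:E)%E)); last first.
  by move=> x _; rewrite normrM powRM// (gtr0_norm ei).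
rewrite ge0_integralZl ?lee_fin ?powR_ge0//.
apply: (@le_trans _ _ ((e^-1 `^ q)%:E * (e `^ q)%:E)%E).
  by apply: lee_wpmul2l => //; rewrite lee_fin powR_ge0.
by rewrite -EFinM -powRM ?(ltW ei) ?(ltW e0')// mulVf ?gt_eqF// powR1.
Qed.

Let v_continuous (f_ : (M -> R)^nat) f : W f ->
  (forall n, measurable_fun setT (f_ n)) ->
  (forall n x, `|f_ n x| <= `|f x|) ->
  (forall x, f_ ^~ x @ \oo --> f x) ->
  v (f_ n) @[n --> \oo] --> v f.
Proof.
move=> Wf mf_ f_f f_cvg; have [mf [n fn] fq] := Wf.
have Wf_ k : W (f_ k) by apply: (Lq_solid q_gt1 Wf).
pose h k x := -1 * f x + f_ k x.
have Wh k : W (h k) := Lq_linear q_gt1 (-1) Wf (Wf_ k).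
have hn k x : ~ B n x -> h k x = 0.
  move=> /fn fx; rewrite /h fx mulr0 add0r; apply/eqP.
  by rewrite -normr_le0 (le_trans (f_f k x))// fx normr0.
have hle k x : `|h k x| <= 2 * `|f x|.
  rewrite /h mulN1r (le_trans (ler_normD _ _))// normrN mulr_natl mulr2n.
  by rewrite lerD2l.
have mh k : measurable_fun setT (h k) by case: (Wh k).
have h0 x : h ^~ x @ \oo --> (0 : R).
  rewrite -(addNr (f x)) /h; under eq_fun do rewrite mulN1r.
  by apply: cvgD; [exact: cvg_cst | exact: f_cvg].
have hq : (\int[mu]_x (`|h k x| `^ q)%:E)%E @[k --> \oo] --> 0%E.
  have p1 : {ae mu, forall x, setT x ->
      (fun k => (`|h k x| `^ q)%:E) @ \oo --> 0%E}.
    apply: aeW => x _; apply: cvg_EFin; first exact: nearW.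
    have q1 : 0 <= q - 1 by rewrite subr_ge0 ltW.
    (* One factor [|h k x|] is kept to tend to 0; the remaining power [q - 1] is bounded by that of
       the majorant. *)
    apply: (@squeeze_cvgr _ _ _ _ (cst 0) (fun k => `|h k x| * (2 * `|f x|) `^ (q - 1))).
    + apply: nearW => k /=; rewrite powR_ge0/= -(@mulr_powRB1 _ `|h k x| q)//.
      by rewrite ler_wpM2l// ge0_ler_powR ?nnegrE ?mulr_ge0.
    + exact: cvg_cst.
    + rewrite -[X in _ --> X](mul0r ((2 * `|f x|) `^ (q - 1))).
      by apply: cvgMr_tmp; rewrite -(normr0 R); apply: cvg_norm.
  have p2 : mu.-integrable setT (fun x => ((2 * `|f x|) `^ q)%:E).
    apply/integrableP; split.
      rewrite (_ : (fun x => _) = (fun x => (`|2 * f x| `^ q)%:E)).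
        by apply: measurable_powR_norm; exact: measurable_funM.
      by apply/funext => x; rewrite normrM ger0_norm.
    under eq_integral do rewrite gee0_abs ?lee_fin ?powR_ge0// powRM// EFinM.
    have mq := measurable_powR_norm q mf.
    rewrite ge0_integralZl ?lee_fin ?powR_ge0//.
    by rewrite lte_mul_pinfty ?lee_fin ?powR_ge0.
  have p3 : {ae mu, forall x k, setT x ->
      (`|(`|h k x| `^ q)%:E| <= ((2 * `|f x|) `^ q)%:E)%E}.
    apply: aeW => x k _; rewrite gee0_abs ?lee_fin ?powR_ge0//.
    by rewrite ge0_ler_powR ?nnegrE ?mulr_ge0 ?(ltW q_gt0).
  have [_ _] := dominated_convergence measurableT
    (fun k => measurable_powR_norm q (mh k)) (measurable_cst 0%E) p1 p2 p3.
  by rewrite integral0.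
have [C C0 hC] := v_small n.
have vh k : v (h k) = v (f_ k) - v f.
  by rewrite addrC -mulN1r; exact: (v_linear (-1) Wf (Wf_ k)).
apply/cvgrPdist_le => e e_gt0.
have eC : 0 < e / C by rewrite divr_gt0.
have ep : (0 < ((e / C) `^ q)%:E)%E by rewrite lte_fin powR_gt0.
near=> k; rewrite distrC -vh.
rewrite (le_trans (hC (e / C) (h k) eC (Wh k) (hn k) _))//; last first.
  by rewrite mulrC divfK ?gt_eqF.
apply: ltW; near: k.
move: hq => /(_ [set y | (y < ((e / C) `^ q)%:E)%E]); apply.
by apply: open_nbhs_nbhs; split; [exact: open_ereal_lt_ereal | exact: ep].
Unshelve. all: by end_near. Qed.

Let density : exists2 b : M -> R, measurable_fun setT b & forall f, W f ->
  mu.-integrable setT (fun x => (f x * b x)%:E) /\ \int[mu]_x (f x * b x) = v f.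
Proof.
pose H := isSigmaFinite.Build _ _ _ (mu : set M -> \bar R) mu_sfin.
pose H' := isSFinite.Build _ _ _ (mu : set M -> \bar R)
  (sfinite_measure_sigma_finite mu_sfin).
pose mu' : {sigma_finite_measure set M -> \bar R} :=
  HB.pack_for (SigmaFiniteMeasure.type M R) (Measure.sort mu) H' H.
have := @riesz_representation d M R mu' W B v.
apply.
- by move=> f [].
- by move=> f g; exact: Lq_solid.
- by move=> c f g; exact: Lq_linear.
- exact: mB.
- move=> n k nk; apply/asboolP => x /lt_le_trans; apply.
  by rewrite ler_nat.
- apply/seteqP; split => // x _.
  by exists (Num.truncn (rho x0 x)).+1 => //; exact: truncnS_gt.
- exact: WB.
- by move=> f [].
- exact: v_linear.
- exact: v_null.
- exact: v_continuous.
Qed.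

Let trunc (N y : R) := Num.max (- N) (Num.min y N).

Let trunc_norm (N y : R) : 0 <= N -> `|trunc N y| <= N.
Proof.
move=> N0; rewrite ler_norml /trunc le_max lexx/= ge_max ge_min lexx orbT andbT.
by rewrite (le_trans _ N0)// oppr_le0.
Qed.

Let trunc_id (N y : R) : `|y| <= N -> trunc N y = y.
Proof.
rewrite ler_norml /trunc => /andP[y1 y2]; rewrite (min_idPl y2).
exact/max_idPr.
Qed.

Let trunc_le (N y : R) : 0 <= N -> `|trunc N y| <= `|y|.
Proof.
move=> N0; have [yN|Ny] := leP `|y| N; first by rewrite trunc_id.
exact: le_trans (trunc_norm y N0) (ltW Ny).
Qed.

(** The property that lets the bound on atoms survive truncation: [trunc N b] is no further from
    [trunc N c] than [b] is from [c], whatever the constant [c]. *)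
Let trunc_dist (N y z : R) : 0 <= N -> `|trunc N y - trunc N z| <= `|y - z|.
Proof.
move=> N0; wlog yz : y z / y <= z => [th|].
  have [|/ltW zy] := leP y z; first exact: th.
  by rewrite distrC (distrC y) th.
rewrite distrC (distrC y) !ger0_norm ?subr_ge0//.
  by rewrite /trunc; case: (leP y N); case: (leP z N); case: (leP (- N) y);
    case: (leP (- N) z); case: (leP (- N) N); lra.
by rewrite /trunc ge_max !le_max lexx/= le_min !ge_min yz lexx !orbT.
Qed.

Let measurable_trunc (N : R) b : measurable_fun setT b ->
  measurable_fun setT (fun x : M => trunc N (b x)).
Proof. by move=> mb; apply: measurable_maxr => //; exact: measurable_minr. Qed.

Let integrable_bounded_mul f (b : M -> R) (K : R) : W f -> measurable_fun setT b ->
  (forall x, `|b x| <= K) -> mu.-integrable setT (fun x => (f x * b x)%:E).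
Proof.
move=> Wf mb bK; have fi := Lq_integrable hM q_gt1 Wf.
apply: (@le_integrable _ _ _ mu setT measurableT _ (fun x => (K%:E * (f x)%:E)%E)).
- by apply/measurable_EFinP; apply: measurable_funM => //; case: Wf.
- move=> x _; rewrite -EFinM !abse_EFin lee_fin !normrM mulrC ler_wpM2r//.
  exact: le_trans (bK x) (ler_norm K).
- exact: integrableZl.
Qed.

(* With [B] the ball of [a] and [c] the mean of [b] over [B], one has
   [|int a b_N| <= int |a| |b - c| = int phi (b - c)] for
   [phi = |a| sgn (b - c)], and [phi] minus its mean is at most 8 times an
   atom.  Thus no [L^q'] bound on [b] is needed. *)
Let trunc_atom b (N : R) a : 0 <= N -> measurable_fun setT b ->
  (forall f, W f -> mu.-integrable setT (fun x => (f x * b x)%:E) /\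
     \int[mu]_x (f x * b x) = v f) ->
  V a -> atom rho mu q (fun y => (a y)%:C) ->
  `|\int[mu]_x (a x * trunc N (b x))| <= 8 * A.
Proof.
move=> N0 mb hb [Wa a0] /(atomP hM q_gt1)[x1 [r [r0 [_ aB _ aq]]]].
have ma : measurable_fun setT a by case: Wa.
have mB' := measurable_closed_qball hM x1 r.
have [m m0 mE] := closed_qball_measure hM x1 r0.
have [n Bn] := closed_qball_sub hM x0 x1 r.
have aB' : {ae mu, forall y, ~ closed_qball rho x1 r y -> a y = 0}.
  by apply: filterS aB => y h /h [].
have {}aq : (\int[mu]_y (`|a y| `^ q)%:E <= (m `^ (1 - q))%:E)%E.
  by under eq_integral do rewrite -cabs_real; rewrite mE in aq.
set B' := closed_qball rho x1 r in mB' mE Bn aB'.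
have W1 : W (\1_B') by exact: (Lq_indic hM q_gt1 mB' Bn).
pose c := m^-1 * v (\1_B').
pose phi x := `|a x| * (Num.sg (b x - c) * \1_B' x).
have phia x : `|phi x| <= `|a x|.
  rewrite /phi !normrM normr_id ler_piMr// normr_sg indicE.
  by rewrite normr_nat -natrM lern1; case: (_ != _); case: (_ \in _).
have mphi : measurable_fun setT phi.
  apply: measurable_funM; first exact: measurableT_comp.
  apply: measurable_funM; last exact: measurable_indic.
  by apply: measurable_fun_sgr; exact: measurable_funB.
have Wphi : W phi by exact: (Lq_solid q_gt1 Wa).
have phiB y : ~ B' y -> phi y = 0 by move=> By; rewrite /phi indicE memNset ?mulr0.
have mq0 : 0 < m `^ (1 - q) by exact: powR_gt0.
have mphiq := measurable_powR_norm q mphi.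
have phiq : (\int[mu]_y (`|phi y| `^ q)%:E <= (m `^ (1 - q))%:E)%E.
  apply: le_trans aq; apply: ge0_le_integral => //.
    exact: measurable_powR_norm.
  by move=> x _; rewrite lee_fin ge0_ler_powR ?nnegrE// ltW.
have I1 : 'I (\1_B' : M -> R) = m.
  by rewrite /Rintegral integral_indic// setIT mE.
have mi : measurable_fun setT (fun x => (\1_B' x)%:E : \bar R).
  by apply/measurable_EFinP; exact: measurable_indic.
have Iphi : `|'I phi| <= 2.
  rewrite -lee_fin EFin_normr_Rintegral//; last exact: (Lq_integrable hM q_gt1 Wphi).
  apply: (le_trans (le_abse_integral _ _ _)) => //; first exact/measurable_EFinP.
  apply: (@le_trans _ _ (\int[mu]_x ((m^-1)%:E * (\1_B' x)%:E +
      (m `^ (q - 1))%:E * (`|phi x| `^ q)%:E))%E).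
    apply: ge0_le_integral => //.
    - by apply/measurable_EFinP; exact: measurableT_comp.
    - by apply: emeasurable_funD; exact: measurable_funeM.
    - move=> x _.
      suff : `|phi x| <= m^-1 * \1_B' x + m `^ (q - 1) * `|phi x| `^ q.
        by rewrite -lee_fin.
      have [xB|xB] := pselect (B' x); last first.
        by rewrite phiB// normr0 addr_ge0 ?mulr_ge0 ?invr_ge0 ?powR_ge0// ltW.
      rewrite indicE mem_set// mulr1 -(ler_pM2l m0) mulrDr mulfV ?gt_eqF// mulrA.
      rewrite mulr_powRB1 ?(ltW m0)// -powRM ?(ltW m0)//.
      by apply: le_onepluspowR; rewrite ?mulr_ge0 ?(ltW m0) ?(ltW q_gt1).
  rewrite ge0_integralD//; last 4 first.
  - by move=> x _; rewrite mule_ge0// lee_fin invr_ge0 ltW.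
  - exact: measurable_funeM.
  - by move=> x _; rewrite mule_ge0// lee_fin powR_ge0.
  - exact: measurable_funeM.
  rewrite !ge0_integralZl ?lee_fin ?powR_ge0 ?invr_ge0 ?(ltW m0)//.
  rewrite integral_indic// setIT mE -EFinM mulVf ?gt_eqF//.
  have -> : 2%:E = (1%:E + (m `^ (q - 1) * m `^ (1 - q))%:E)%E :> \bar R.
    rewrite -powRD; last by rewrite (gt_eqF m0) implybT.
    by rewrite addrC subrKA subrr powRr0 -EFinD.
  by rewrite leeD2l// EFinM lee_wpmul2l// lee_fin powR_ge0.
pose psi x := - ('I phi / m) * \1_B' x + phi x.
have Wpsi : W psi := Lq_linear q_gt1 (- ('I phi / m)) W1 Wphi.
have psi0 : 'I psi = 0.
  rewrite (integral_lin (- ('I phi / m)) W1 Wphi) I1 mulNr divfK ?gt_eqF//.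
  by rewrite addNr.
have psiB y : ~ B' y -> psi y = 0.
  by move=> By; rewrite /psi phiB// indicE memNset// mulr0 addr0.
have two_q : 2 <= 2 `^ q :> R by rewrite le1r_powR ?ler1n ?(ltW q_gt1).
have psiq : (\int[mu]_y (`|psi y| `^ q)%:E <= (8 `^ q * m `^ (1 - q))%:E)%E.
  apply: (le_trans (integral_powR_lin q_gt1 _ _ mphi)).
    exact: measurable_indic.
  have -> : (\int[mu]_y (`|(\1_B' : M -> R) y| `^ q)%:E = m%:E)%E.
    rewrite -mE -[X in _ = mu X]setIT -integral_indic//; apply: eq_integral => y _.
    rewrite indicE normr_nat; case: (_ \in _); rewrite ?powR1//.
    by rewrite powR0// gt_eqF.
  apply: (@le_trans _ _ ((2 `^ q)%:E * ((2 `^ q * m `^ (1 - q))%:E + (m `^ (1 - q))%:E))%E).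
    apply: lee_wpmul2l; first by rewrite lee_fin powR_ge0.
    apply: leeD => //; rewrite -EFinM lee_fin normrN normrM.
    rewrite powRM// normfV (gtr0_norm m0) -mulrA ler_pM ?mulr_ge0 ?powR_ge0 ?(ltW m0)//.
      by rewrite ge0_ler_powR ?nnegrE// ltW.
    rewrite powRB; last by rewrite (gt_eqF m0) implybT.
    rewrite powRr1 ?(ltW m0)// mulrC.
    by rewrite -(powR_inv1 (ltW m0)) -powRrM mulN1r powRN.
  rewrite -EFinD -EFinM lee_fin -[X in _ * (_ + X)]mul1r -mulrDl mulrA ler_wpM2r ?(ltW mq0)//.
  have -> : 8 `^ q = 2 `^ q * (2 `^ q * 2 `^ q) :> R.
    by rewrite -!powRM ?mulr_ge0//; congr (_ `^ _); ring.
  rewrite ler_wpM2l ?powR_ge0//.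
  by have := powR_ge0 (2:R) q; nra.
have Vpsi : V psi by split.
have a8 : atom rho mu q (fun y => (8^-1 * psi y)%:C).
  apply: (@Lq0_atom _ _ _ _ _ hM _ q_gt1 8 (8 `^ q * m `^ (1 - q)) psi x1 r) => //.
  - by case: Wpsi.
  - exact: (Lq_integrable hM q_gt1 Wpsi).
  - by rewrite -/B' mE.
have V0 : V (cst 0) by split => //; rewrite Rintegral_cst// mul0r.
have upsi : `|v psi| <= 8 * A.
  have := @u_atom (fun x => 8^-1 * psi x).
  have -> : (fun x => 8^-1 * psi x) = (fun x => 8^-1 * psi x + (cst 0) x).
    by apply/funext => x; rewrite addr0.
  move=> /(_ (Lq0_linear hM q_gt1 8^-1 Vpsi V0) a8).
  rewrite u_linear// -(vE V0) v0 addr0 -(vE Vpsi) normrM gtr0_norm ?invr_gt0//.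
  by rewrite ler_pdivrMl.
apply: le_trans upsi.
(* Removing the mean of [phi] from the argument of [v] has the same effect as removing the mean [c]
   from [b]. *)
have vpsi : v psi = \int[mu]_x (phi x * (b x - c)).
  have [phibi phibE] := hb _ Wphi.
  have -> : \int[mu]_x (phi x * (b x - c)) = \int[mu]_x (phi x * b x - c * phi x).
    by apply: eq_Rintegral => x _; rewrite mulrBr (mulrC _ c).
  have phii := Lq_integrable hM q_gt1 Wphi.
  rewrite RintegralB//; last exact: (integrableZl measurableT c phii).
  rewrite RintegralZl// phibE (v_linear (- ('I phi / m)) W1 Wphi) addrC.
  congr (_ + _).
  by rewrite /c mulNr; congr (- _); ring.
rewrite vpsi.
have trc x : `|trunc N (b x) - trunc N c| <= N + N.
  by rewrite (le_trans (ler_normB _ _))// lerD// trunc_norm.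
have mtr : measurable_fun setT (fun x => trunc N (b x) - trunc N c).
  by apply: measurable_funB => //; exact: measurable_trunc.
have ai := Lq_integrable hM q_gt1 Wa.
(* The constant [trunc N c] can be inserted because [a] has integral 0. *)
have -> : \int[mu]_x (a x * trunc N (b x)) =
    \int[mu]_x (a x * (trunc N (b x) - trunc N c)).
  under [RHS]eq_Rintegral do rewrite mulrBr.
  rewrite RintegralB//; last 2 first.
  - apply: (@integrable_bounded_mul _ _ N) => //; first exact: measurable_trunc.
    by move=> x; exact: trunc_norm.
  - by apply: (@integrable_bounded_mul _ _ N) => // x; exact: trunc_norm.
  by rewrite RintegralZr// a0 mul0r subr0.
have ati := integrable_bounded_mul Wa mtr trc.
apply: (le_trans (le_normr_Rintegral measurableT ati)).
have phibci : mu.-integrable setT (fun x => (phi x * (b x - c))%:E).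
  have [phibi _] := hb _ Wphi.
  have phii := Lq_integrable hM q_gt1 Wphi.
  apply: (@eq_integrable _ _ _ mu setT measurableT
    ((fun x => (phi x * b x)%:E) \- (fun x => (c%:E * (phi x)%:E)))%E).
    by move=> x _ /=; rewrite mulrBr EFinB EFinM (mulrC (phi x) c).
  by apply: integrableB => //; exact: integrableZl.
apply: (le_trans _ (ler_norm _)).
rewrite -lee_fin /Rintegral !fineK; last 2 first.
- exact: integrable_fin_num.
- exact/integrable_fin_num/integrable_norm.
(* On [B'] the right integrand is [|a x| * |b x - c|], by the choice of sign in [phi], and
   [trunc_dist] applies; off [B'] both sides vanish almost everywhere. *)
apply: ae_ge0_le_integral => //.
- apply/measurable_EFinP; apply: measurableT_comp => //.
  exact: measurable_funM.
- move=> x _; rewrite lee_fin /phi -mulrA -mulrA mulr_ge0//.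
  by rewrite mulrCA mulr_ge0// -normrEsg.
- by case/integrableP: phibci.
- apply: filterS aB' => x ax _; rewrite lee_fin normrM.
  have [xB|/ax ax0] := pselect (B' x); last by rewrite /phi ax0 normr0 !mul0r.
  rewrite /phi indicE mem_set// mulr1 -mulrA.
  by rewrite ler_wpM2l// -normrEsg trunc_dist.
Qed.

(* [g] is paired with the truncations of the density of [u], which are bounded;
   dominated convergence removes the truncation. *)
Lemma functional_le_bounded_tests (K : R) g : V g ->
  (forall beta : M -> R, measurable_fun setT beta ->
    (exists C, forall x, `|beta x| <= C) ->
    (forall a, V a -> atom rho mu q (fun y => (a y)%:C) ->
      `|\int[mu]_x (a x * beta x)| <= 1) ->
    `|\int[mu]_x (g x * beta x)| <= K) ->
  `|u g| <= 8 * A * K.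
Proof.
move=> Vg gK; have [Wg _] := Vg; have [b mb hb] := density.
have mg : measurable_fun setT g by case: Wg.
have A8 : 0 < 8 * A by exact: mulr_gt0.
have gN (N : nat) : `|\int[mu]_x (g x * trunc N%:R (b x))| <= 8 * A * K.
  have tb x : `|trunc N%:R (b x)| <= N%:R by exact: trunc_norm.
  have mt := @measurable_trunc N%:R _ mb.
  (* By [trunc_atom], the factor [(8 * A)^-1] brings the pairing with every atom down to at most 1,
     for all [N] at once. *)
  pose beta x := (8 * A)^-1 * trunc N%:R (b x).
  have scale f : W f -> \int[mu]_x (f x * beta x) =
      (8 * A)^-1 * \int[mu]_x (f x * trunc N%:R (b x)).
    move=> Wf; rewrite -RintegralZl//; last exact: (integrable_bounded_mul Wf mt tb).
    by apply: eq_Rintegral => x _; rewrite /beta mulrCA.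
  have := gK beta; rewrite scale// normrM gtr0_norm ?invr_gt0// ler_pdivrMl//; apply.
  - exact: measurable_funM.
  - exists ((8 * A)^-1 * N%:R) => x; rewrite /beta normrM gtr0_norm ?invr_gt0//.
    by rewrite ler_wpM2l// invr_ge0 ltW.
  - move=> a Va aa; have [Wa _] := Va.
    rewrite scale// normrM gtr0_norm ?invr_gt0// ler_pdivrMl// mulr1.
    exact: trunc_atom.
have [gbi gbE] := hb _ Wg.
have mEg : measurable_fun setT (fun x => (g x * b x)%:E).
  by case/integrableP: gbi.
have m1 N : measurable_fun setT (fun x => (g x * trunc N%:R (b x))%:E).
  by apply/measurable_EFinP/measurable_funM => //; exact: measurable_trunc.
have p1 : {ae mu, forall x, setT x ->
    (fun N : nat => (g x * trunc N%:R (b x))%:E) @ \oo --> (g x * b x)%:E}.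
  apply: aeW => x _; apply: cvg_near_cst; near=> N.
  rewrite trunc_id//; near: N; exact: nbhs_infty_ger.
have p3 : {ae mu, forall x (N : nat), setT x ->
    (`|(g x * trunc N%:R (b x))%:E| <= (abse \o (fun x => (g x * b x)%:E)) x)%E}.
  apply: aeW => x N _; rewrite lee_fin !normrM ler_wpM2l//.
  exact: trunc_le.
have [_ _ lim] := dominated_convergence measurableT m1 mEg p1
  (integrable_abse gbi) p3.
have : \int[mu]_x (g x * trunc N%:R (b x)) @[N --> \oo] --> \int[mu]_x (g x * b x).
  by apply: fine_cvg; rewrite fineK//; exact: integrable_fin_num.
rewrite gbE (vE Vg) => /cvg_norm limn.
by apply: (@cvgr_to_le _ _ _ _ _ _ _ limn); exact: nearW.
Unshelve. all: by end_near. Qed.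

End atom_bounded_functional.

(** * The space L^1 of complex functions *)

Section L1_norm.
Context {R : realType} {d : measure_display} {M : measurableType d}.
Variable mu : {measure set M -> \bar R}.
Implicit Types f g h : M -> R[i].

Lemma cmeasurable_sub f g : cmeasurable f -> cmeasurable g ->
  cmeasurable (fun x => f x - g x).
Proof.
move=> mf mg; have := cmeasurable_lin (-1) mg mf.
by congr cmeasurable; apply/funext => x; rewrite mulN1r addrC.
Qed.

Lemma cLp1_measurable f : cLp mu 1%E f -> cmeasurable f.
Proof. by case. Qed.

Lemma measurable_cabs f : cmeasurable f ->
  measurable_fun setT (fun x => (cabs (f x))%:E : \bar R).
Proof. by move=> mf; apply/measurable_EFinP; exact: cmeasurable_cabs. Qed.

Lemma cLnorm1_lin (c : R[i]) f g : cmeasurable f -> cmeasurable g ->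
  (cLnorm mu 1 (fun x => c * f x + g x)%R
     <= (cabs c)%:E * cLnorm mu 1 f + cLnorm mu 1 g)%E.
Proof.
move=> mf mg; rewrite !cLnorm1E.
have m1 := measurable_cabs mf; have m2 := measurable_cabs mg.
have c0 (z : R[i]) : (0 <= (cabs z)%:E)%E by rewrite lee_fin cabs_ge0.
rewrite -ge0_integralZl//.
have m3 : measurable_fun setT (fun x => (cabs c)%:E * (cabs (f x))%:E)%E.
  exact: measurable_funeM.
rewrite -ge0_integralD//; last by move=> x _; rewrite mule_ge0.
apply: ge0_le_integral => //.
- by apply: measurable_cabs; exact: cmeasurable_lin.
- exact: emeasurable_funD.
- move=> x _; suff : cabs (c * f x + g x) <= cabs c * cabs (f x) + cabs (g x).
    by rewrite -lee_fin.
  by rewrite (le_trans (cabsD _ _))// cabsM.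
Qed.

Lemma cLp1_lin (c : R[i]) f g : cLp mu 1%E f -> cLp mu 1%E g ->
  cLp mu 1%E (fun x => c * f x + g x).
Proof.
move=> [mf fy] [mg gy]; split; first exact: cmeasurable_lin.
apply: (le_lt_trans (cLnorm1_lin c mf mg)).
by rewrite lte_add_pinfty// lte_mul_pinfty// lee_fin cabs_ge0.
Qed.

Lemma cLp1_sub f g : cLp mu 1%E f -> cLp mu 1%E g ->
  cLp mu 1%E (fun x => f x - g x).
Proof.
move=> Lf Lg; have := cLp1_lin (-1) Lg Lf.
by congr (cLp _ _ _); apply/funext => x; rewrite mulN1r addrC.
Qed.

Lemma cLnorm1_sub_le f g h : cmeasurable f -> cmeasurable g -> cmeasurable h ->
  (cLnorm mu 1 (fun x => f x - g x)%R <=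
   cLnorm mu 1 (fun x => f x - h x)%R + cLnorm mu 1 (fun x => g x - h x)%R)%E.
Proof.
move=> mf mg mh.
have := cLnorm1_lin (-1) (cmeasurable_sub mg mh) (cmeasurable_sub mf mh).
have -> : (fun x => -1 * (g x - h x) + (f x - h x)) = (fun x => f x - g x).
  by apply/funext => x; ring.
by rewrite cabsN (_ : cabs 1 = 1) ?mul1e 1?addeC// cabs_real normr1.
Qed.

Lemma cLnorm1_le f g : cmeasurable f -> cmeasurable g ->
  (cLnorm mu 1 f <= cLnorm mu 1 (fun x => f x - g x)%R + cLnorm mu 1 g)%E.
Proof.
move=> mf mg.
have sub := cmeasurable_sub mf mg.
have := cLnorm1_lin 1 sub mg; rewrite (_ : cabs 1 = 1) ?mul1e.
  by under [X in cLnorm _ _ X]funext do rewrite mul1r subrK.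
by rewrite cabs_real normr1.
Qed.

Lemma cLnorm_ge0 (p : \bar R) f : (0 <= cLnorm mu p f)%E.
Proof. exact: Lnorm_ge0. Qed.

Lemma cLnorm1_ae f g : cmeasurable f -> cmeasurable g -> f = g %[ae mu] ->
  cLnorm mu 1 f = cLnorm mu 1 g.
Proof.
move=> mf mg fg; rewrite !cLnorm1E; apply: ae_eq_integral => //.
- exact: measurable_cabs.
- exact: measurable_cabs.
- by apply: filterS fg => x /[apply] ->.
Qed.

Lemma cLnorm1_sub_eq0 f g : cmeasurable f -> cmeasurable g ->
  cLnorm mu 1 (fun x => f x - g x) = 0%E -> f = g %[ae mu].
Proof.
move=> mf mg.
have sub := cmeasurable_sub mf mg.
have := Lnorm_eq0_eq0 (measurable_cabs sub) (@lte01 R).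
rewrite /cLnorm => /[apply]; apply: filterS => x /[apply] /= [[h]].
by apply/eqP; rewrite -subr_eq0; apply/eqP/Normc.eq0_normc.
Qed.

Lemma cvg0_ereal_near (u : (\bar R)^nat) : u n @[n --> \oo] --> 0%E ->
  forall e : R, 0 < e -> \forall n \near \oo, (u n <= e%:E)%E.
Proof.
move=> u0 e e0; have : \forall n \near \oo, (u n < e%:E)%E.
  move: u0 => /(_ [set y | (y < e%:E)%E]); apply.
  by apply: open_nbhs_nbhs; split; [exact: open_ereal_lt_ereal | rewrite /= lte_fin].
by apply: filterS => n /ltW.
Qed.

Lemma near_cvg0_ereal (u : (\bar R)^nat) : (forall n, 0 <= u n)%E ->
  (forall e : R, 0 < e -> \forall n \near \oo, (u n <= e%:E)%E) ->
  u n @[n --> \oo] --> 0%E.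
Proof.
move=> u0 h; apply/fine_cvgP; split.
  apply: filterS (h 1 ltr01) => n un; rewrite ge0_fin_numE//.
  by rewrite (le_lt_trans un)// ltry.
apply/cvgrPdist_le => e e0; apply: filterS (h e e0) => n un.
rewrite sub0r normrN ger0_norm ?fine_ge0// -lee_fin fineK// ge0_fin_numE//.
by rewrite (le_lt_trans un)// ltry.
Qed.

(** The Riesz-Fischer argument: the sum [G] of the absolute values is integrable, hence finite a.e.;
    it gives pointwise convergence of the series and also dominates all its partial sums. *)
Lemma L1_series_complete_real (f_ : nat -> M -> R) :
  (forall n, measurable_fun setT (f_ n)) ->
  (\sum_(0 <= n <oo) \int[mu]_x `|f_ n x|%:E < +oo)%E ->
  exists f : M -> R, [/\ measurable_fun setT f, mu.-integrable setT (EFin \o f) &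
    (\int[mu]_x `|(f x - \sum_(0 <= j < n) f_ j x)%:E|)%E @[n --> \oo] --> 0%E].
Proof.
move=> mf fy; pose G x := (\sum_(0 <= n <oo) `|f_ n x|%:E)%E.
have mn n : measurable_fun setT (fun x => `|f_ n x|%:E : \bar R).
  by apply/measurable_EFinP; exact: measurableT_comp.
have Gi : mu.-integrable setT G.
  apply/integrableP; split.
    by apply: ge0_emeasurable_sum => // n x _ _; rewrite lee_fin.
  under eq_integral do rewrite gee0_abs ?nneseries_ge0//.
  by rewrite integral_nneseries.
have Gfin := integrable_ae measurableT Gi.
pose S n x : R := \sum_(0 <= j < n) f_ j x.
have mS n : measurable_fun setT (S n) by exact: measurable_sum.
have [N [mN N0 NG]] := Gfin.
have Gcvg x : ~ N x -> cvgn (S ^~ x).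
  move=> Nx; have Gx : G x \is a fin_num.
    by apply: contrapT => nG; apply: Nx; apply: NG => /= /(_ I).
  apply: normed_cvg; apply: nondecreasing_is_cvgn.
    by apply: nondecreasing_series => n _ _; exact: normr_ge0.
  exists (fine (G x)) => _ [n _ <-] /=.
  rewrite -lee_fin fineK// /series/= -sumEFin.
  by apply: nneseries_lim_ge => k _ _; rewrite lee_fin.
(* With the value 0 on the null set [N], [f] is the limit at every point of the partial sums cut to
   the complement of [N], so it is measurable. *)
pose f x := if x \in N then 0 else limn (S ^~ x).
have mf' : measurable_fun setT f.
  apply: (@measurable_fun_cvg _ _ _ setT (fun n x => S n x * \1_(~` N) x)).
    move=> n; apply: measurable_funM => //; apply: measurable_indic.
    exact: measurableC.
  move=> x _; rewrite /f indicE in_setC; case: ifPn => /= xN.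
    by under eq_fun do rewrite mulr0; exact: cvg_cst.
  under eq_fun do rewrite mulr1.
  by apply: Gcvg => /mem_set; exact/negP.
have Sf : {ae mu, forall x, setT x -> (fun n => (S n x)%:E) @ \oo --> (f x)%:E}.
  exists N; split => // x /= /not_implyP[_]; apply: contra_notP => Nx.
  apply: cvg_EFin; first exact: nearW.
  by rewrite /f memNset//; exact: Gcvg.
have SG : {ae mu, forall x n, setT x -> (`|(S n x)%:E| <= G x)%E}.
  apply: aeW => x n _; rewrite abse_EFin.
  apply: (@le_trans _ _ (\sum_(0 <= j < n) `|f_ j x|%:E)%E).
    by rewrite sumEFin lee_fin ler_norm_sum.
  by apply: nneseries_lim_ge => k _ _; rewrite lee_fin.
have mES n : measurable_fun setT (fun x => (S n x)%:E) by exact/measurable_EFinP.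
have mEf : measurable_fun setT (fun x => (f x)%:E) by exact/measurable_EFinP.
have [fi f0 _] := dominated_convergence measurableT mES mEf Sf Gi SG.
exists f; split => //; apply: cvg_trans f0; apply: near_eq_cvg; apply: nearW => n /=.
by apply: eq_integral => x _; exact: (congr1 EFin (distrC _ _)).
Qed.

Lemma complex_sum_Re_Im (n : nat) (F : nat -> R[i]) :
  \sum_(0 <= j < n) F j = (\sum_(0 <= j < n) complex.Re (F j)) +i*
    (\sum_(0 <= j < n) complex.Im (F j)).
Proof.
elim: n => [|n ih]; first by rewrite !big_nil.
by rewrite !big_nat_recr//= ih; case: (F n).
Qed.

Lemma L1_series_complete (F : nat -> M -> R[i]) : (forall n, cLp mu 1%E (F n)) ->
  (\sum_(0 <= n <oo) cLnorm mu 1 (F n) < +oo)%E ->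
  exists f, cLp mu 1%E f /\
    cLnorm mu 1 (fun x => f x - \sum_(0 <= j < n) F j x) @[n --> \oo] --> 0%E.
Proof.
move=> LF Fy.
have part (p : R[i] -> R) : (forall z, `|p z| <= cabs z) ->
    (forall n, measurable_fun setT (fun x => p (F n x))) ->
    (\sum_(0 <= n <oo) \int[mu]_x `|p (F n x)|%:E < +oo)%E.
  move=> pc mp; apply: le_lt_trans Fy; apply: lee_nneseries.
    by move=> n _ _; apply: integral_ge0 => x _; rewrite lee_fin.
  move=> n _; rewrite cLnorm1E; apply: ge0_le_integral => //.
  - by apply/measurable_EFinP; exact: measurableT_comp.
  - by apply: measurable_cabs; case: (LF n).
  - by move=> x _; rewrite lee_fin pc.
have mR n : measurable_fun setT (fun x => complex.Re (F n x)).
  by case: (LF n) => [[h _] _].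
have mI n : measurable_fun setT (fun x => complex.Im (F n x)).
  by case: (LF n) => [[_ h] _].
have [f1 [mf1 if1 c1]] := L1_series_complete_real mR (part _ (@normr_Re_le R) mR).
have [f2 [mf2 if2 c2]] := L1_series_complete_real mI (part _ (@normr_Im_le R) mI).
have Lf : cLp mu 1%E (fun x => f1 x +i* f2 x) by apply/cL1P.
have LS n : cLp mu 1%E (fun x => \sum_(0 <= j < n) F j x).
  elim: n => [|n ih].
    under eq_fun do rewrite big_nil; apply/cL1P; split; exact: integrable0.
  under eq_fun do rewrite big_nat_recr//=.
  have := cLp1_lin 1 ih (LF n).
  by congr (cLp _ _ _); apply/funext => x; rewrite mul1r.
exists (fun x => f1 x +i* f2 x); split => //.
apply: (@squeeze_cvge _ _ _ _ (cst 0%E) _ (fun n =>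
  \int[mu]_x `|(f1 x - \sum_(0 <= j < n) complex.Re (F j x))%:E| +
  \int[mu]_x `|(f2 x - \sum_(0 <= j < n) complex.Im (F j x))%:E|)%E).
- apply: nearW => n; rewrite cLnorm_ge0/= cLnorm1E.
  have m1 : measurable_fun setT (fun x => `|(f1 x - \sum_(0 <= j < n) complex.Re (F j x))%:E|)%E.
    apply: measurableT_comp => //; apply/measurable_EFinP; apply: measurable_funB => //.
    exact: measurable_sum.
  have m2 : measurable_fun setT (fun x => `|(f2 x - \sum_(0 <= j < n) complex.Im (F j x))%:E|)%E.
    apply: measurableT_comp => //; apply/measurable_EFinP; apply: measurable_funB => //.
    exact: measurable_sum.
  rewrite -ge0_integralD//; apply: ge0_le_integral => //.
  + by move=> x _; rewrite lee_fin cabs_ge0.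
  + by apply/measurable_cabs/cmeasurable_sub; [case: Lf | case: (LS n)].
  + exact: emeasurable_funD.
  + move=> x _; rewrite complex_sum_Re_Im.
    exact: (cabs_le ((f1 x +i* f2 x) - (_ +i* _))).
- exact: cvg_cst.
- by rewrite -(adde0 0%E); apply: cvgeD.
Qed.

End L1_norm.

(** * Bounded test functions *)

Section bounded_tests.
Context {R : realType} {d : measure_display} {M : measurableType d}.
Context {rho : M -> M -> R} {mu : {measure set M -> \bar R}}.
Hypothesis hM : homogeneous_type rho mu.
Context {q : R}.
Hypothesis q_gt1 : 1 < q.
Variable x0 : M.
Implicit Types f g h : M -> R[i].

Local Notation V := (@Lq0_bounded_support R d M rho mu q x0).

(* The bounded elements of the unit ball of the dual of the atomic space. *)
Definition bounded_test (beta : M -> R) : Prop :=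
  [/\ measurable_fun setT beta, exists C, forall x, `|beta x| <= C &
    forall a : M -> R, V a -> atom rho mu q (fun y => (a y)%:C) ->
      `|\int[mu]_x (a x * beta x)| <= 1].

(** The relation [N(f) <= c] of the overview, written without a supremum, so that no finiteness has
    to be tracked. The tests are real and see the two parts of [f] separately. *)
Definition test_norm_le f (c : R) : Prop := forall beta, bounded_test beta ->
  `|\int[mu]_x (complex.Re (f x) * beta x)| <= c /\
  `|\int[mu]_x (complex.Im (f x) * beta x)| <= c.

Lemma integrable_mul_test (f beta : M -> R) :
  mu.-integrable setT (EFin \o f) -> bounded_test beta ->
  mu.-integrable setT (fun x => (f x * beta x)%:E).
Proof.
move=> fi [mb [C bC] _].
apply: (@le_integrable _ _ _ mu setT measurableT _ (fun x => (C%:E * (f x)%:E)%E)).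
- apply/measurable_EFinP; apply: measurable_funM => //.
  by case/integrableP: fi => /measurable_EFinP.
- move=> x _; rewrite -EFinM !abse_EFin lee_fin !normrM mulrC ler_wpM2r//.
  exact: le_trans (bC x) (ler_norm C).
- exact: integrableZl.
Qed.

Lemma integral_mul_ae (f g beta : M -> R) : measurable_fun setT f ->
  measurable_fun setT g -> measurable_fun setT beta ->
  {ae mu, forall x, f x = g x} ->
  \int[mu]_x (f x * beta x) = \int[mu]_x (g x * beta x).
Proof.
move=> mf mg mb fg; rewrite /Rintegral; congr fine; apply: ae_eq_integral => //.
- by apply/measurable_EFinP; exact: measurable_funM.
- by apply/measurable_EFinP; exact: measurable_funM.
- by apply: filterS fg => x -> _.
Qed.

Lemma integral_lin_mul_test (c e : R) (f g h beta : M -> R) :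
  mu.-integrable setT (EFin \o f) -> mu.-integrable setT (EFin \o g) ->
  mu.-integrable setT (EFin \o h) -> bounded_test beta ->
  \int[mu]_x ((c * f x + e * g x + h x) * beta x) =
  c * \int[mu]_x (f x * beta x) + e * \int[mu]_x (g x * beta x) +
  \int[mu]_x (h x * beta x).
Proof.
move=> fi gi hi tb.
have fbi := integrable_mul_test fi tb; have gbi := integrable_mul_test gi tb.
have hbi := integrable_mul_test hi tb.
under eq_Rintegral do rewrite mulrDl mulrDl -!mulrA.
have cfi := integrableZl measurableT c fbi.
have egi := integrableZl measurableT e gbi.
rewrite RintegralD//; last exact: (integrableD measurableT cfi egi).
by rewrite RintegralD// !RintegralZl.
Qed.

Lemma test_norm_le_ae f g c : cmeasurable f -> cmeasurable g ->
  f = g %[ae mu] -> test_norm_le f c -> test_norm_le g c.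
Proof.
move=> [fR fI] [gR gI] fg fc beta tb; have [mb _ _] := tb.
have [h1 h2] := fc beta tb.
split; [apply: le_trans h1|apply: le_trans h2];
  rewrite le_eqVlt; apply/orP; left; apply/eqP; congr (`| _ |);
  apply: integral_mul_ae => //; by apply: filterS fg => x /(_ I) ->.
Qed.

(** A bounded test controls only real atoms belonging to [V]; [atom_Re_Im] replaces the two parts of
    [a] by such atoms, up to null sets. *)
Lemma test_norm_le_atom a : atom rho mu q a -> test_norm_le a 1.
Proof.
move=> aa; have [a1 [a2 [V1 V2 A1 A2 e]]] := atom_Re_Im hM q_gt1 x0 aa.
have /(atomP hM q_gt1)[_ [_ [_ [[mR mI] _ _ _]]]] := aa.
move=> beta [mb bb ba]; have [[[m1 _ _] _] [[m2 _ _] _]] := (V1, V2).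
have e1 : {ae mu, forall x, complex.Re (a x) = a1 x}.
  by apply: filterS e => x /(_ I) ->; rewrite ReD ReM /= ; ring.
have e2 : {ae mu, forall x, complex.Im (a x) = a2 x}.
  by apply: filterS e => x /(_ I) ->; rewrite ImD ImM /= ; ring.
by rewrite (integral_mul_ae mR m1)// (integral_mul_ae mI m2)//; split; apply: ba.
Qed.

(** The factor 2 arises because each part of [z * f] mixes both parts of [f], with coefficients
    bounded by [cabs z]. *)
Lemma test_norm_le_lin (z : R[i]) f g (c e : R) : cLp mu 1%E f -> cLp mu 1%E g ->
  test_norm_le f c -> test_norm_le g e ->
  test_norm_le (fun x => z * f x + g x) (2 * cabs z * c + e).
Proof.
move=> /cL1P[fR fI] /cL1P[gR gI] fc ge beta tb.
have [f1 f2] := fc _ tb; have [g1 g2] := ge _ tb.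
have z1 := normr_Re_le z; have z2 := normr_Im_le z.
have c0 : 0 <= c by apply: le_trans f1.
split.
  under eq_Rintegral do rewrite ReD ReM -mulNr.
  rewrite (@integral_lin_mul_test _ _ (fun x => complex.Re (f x)) (fun x => complex.Im (f x)) (fun x => complex.Re (g x)))//.
  rewrite (le_trans (ler_normD _ _))// lerD//.
  rewrite (le_trans (ler_normD _ _))// !normrM normrN.
  by rewrite -mulrA mulr_natl mulr2n lerD// ler_pM.
under eq_Rintegral do rewrite ImD ImM.
rewrite (@integral_lin_mul_test _ _ (fun x => complex.Im (f x)) (fun x => complex.Re (f x)) (fun x => complex.Im (g x)))//.
rewrite (le_trans (ler_normD _ _))// lerD//.
rewrite (le_trans (ler_normD _ _))// !normrM.
by rewrite -mulrA mulr_natl mulr2n lerD// ler_pM.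
Qed.

Lemma test_norm_le_sub f g h (c e : R) : cLp mu 1%E f -> cLp mu 1%E g ->
  cLp mu 1%E h -> test_norm_le (fun x => f x - g x) c ->
  test_norm_le (fun x => f x - h x) e ->
  test_norm_le (fun x => g x - h x) (2 * c + e).
Proof.
move=> Lf Lg Lh fg fh.
have := test_norm_le_lin (-1) (cLp1_sub Lf Lg) (cLp1_sub Lf Lh) fg fh.
rewrite cabsN (_ : cabs 1 = 1) ?mulr1; last by rewrite cabs_real normr1.
by congr (test_norm_le _ _); apply/funext => x; ring.
Qed.

(* Lower semicontinuity under L^1 convergence, since tests are bounded. *)
Lemma test_norm_le_limit (f_ : nat -> M -> R[i]) f (c : R) :
  (forall n, cLp mu 1%E (f_ n)) -> cLp mu 1%E f ->
  cLnorm mu 1 (fun x => f x - f_ n x) @[n --> \oo] --> 0%E ->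
  (\forall n \near \oo, test_norm_le (f_ n) c) -> test_norm_le f c.
Proof.
move=> Lf_ Lf cvgf fc beta tb; have [mb [C bC] _] := tb.
have C0 : 0 <= C by apply: le_trans (bC x0).
have part (p : R[i] -> R) : (forall z w, p (z - w) = p z - p w) ->
    (forall z, `|p z| <= cabs z) ->
    (forall g, cLp mu 1%E g -> mu.-integrable setT (EFin \o (p \o g))) ->
    (\forall n \near \oo, `|\int[mu]_x (p (f_ n x) * beta x)| <= c) ->
    `|\int[mu]_x (p (f x) * beta x)| <= c.
  move=> pB pc pi pfc; apply/ler_addgt0Pr => e e0.
  (* [C] is the sup bound of the test and may be 0, hence the divisor [C + 1]. *)
  have eC : 0 < e / (C + 1) by rewrite divr_gt0// ltr_wpDl.
  near \oo => n.
  have h1 : `|\int[mu]_x (p (f_ n x) * beta x)| <= c by near: n.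
  have h2 : (cLnorm mu 1 (fun x => f x - f_ n x)%R <= (e / (C + 1))%:E)%E.
    by near: n; exact: cvg0_ereal_near.
  have Ld := cLp1_sub Lf (Lf_ n).
  have i1 := integrable_mul_test (pi _ Lf) tb.
  have i2 := integrable_mul_test (pi _ (Lf_ n)) tb.
  have i3 := integrable_mul_test (pi _ Ld) tb.
  have -> : \int[mu]_x (p (f x) * beta x) = \int[mu]_x (p (f_ n x) * beta x) +
      \int[mu]_x (p (f x - f_ n x) * beta x).
    rewrite -RintegralD//; apply: eq_Rintegral => x _.
    by rewrite pB -mulrDl addrC subrK.
  rewrite (le_trans (ler_normD _ _))// lerD//.
  rewrite -lee_fin EFin_normr_Rintegral//.
  apply: (le_trans (le_abse_integral _ _ _)) => //; first by case/integrableP: i3.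
  apply: (@le_trans _ _ (C%:E * cLnorm mu 1 (fun x => f x - f_ n x)%R)%E); last first.
    apply: (@le_trans _ _ (C%:E * (e / (C + 1))%:E)%E); first exact: lee_wpmul2l.
    rewrite -EFinM lee_fin mulrCA ler_piMr ?(ltW e0)// ler_pdivrMr ?ltr_wpDl//.
    by rewrite mul1r lerDl.
  have md := measurable_cabs (cLp1_measurable Ld).
  rewrite cLnorm1E -ge0_integralZl ?lee_fin//; last first.
    by move=> x _; rewrite lee_fin cabs_ge0.
  apply: ge0_le_integral => //.
  - by apply: measurableT_comp => //; case/integrableP: i3.
  - exact: measurable_funeM.
  - move=> x _; suff : `|p (f x - f_ n x) * beta x| <= C * cabs (f x - f_ n x).
      by rewrite -lee_fin.
    by rewrite normrM mulrC ler_pM.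
have subR (z w : R[i]) : complex.Re (z - w) = complex.Re z - complex.Re w.
  by case: z w => ? ? [? ?].
have subI (z w : R[i]) : complex.Im (z - w) = complex.Im z - complex.Im w.
  by case: z w => ? ? [? ?].
split; apply: part => //; try exact: normr_Re_le; try exact: normr_Im_le;
  try by move=> g /cL1P[].
- by apply: filterS fc => n /(_ _ tb)[].
- by apply: filterS fc => n /(_ _ tb)[].
Unshelve. all: by end_near. Qed.

(** * The bound for the operator on finite combinations of atoms *)

Section operator_bound.
Hypothesis mu_sfin : sigma_finite setT mu.
Variables (T : (M -> R[i]) -> M -> R[i]) (A : R).
Hypothesis T_linear : linear_to_L1 mu (Hfin rho mu q) T.
Hypothesis A_gt0 : 0 < A.
Hypothesis T_atom : forall a, atom rho mu q a -> (cLnorm mu 1 (T a) <= A%:E)%E.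

Lemma Hfin_lin (z : R[i]) f g : Hfin rho mu q f -> Hfin rho mu q g ->
  Hfin rho mu q (fun x => z * f x + g x).
Proof.
move=> /(HfinP hM q_gt1 x0)[Lf [f1 [f2 [V1 V2 e]]]].
move=> /(HfinP hM q_gt1 x0)[Lg [g1 [g2 [U1 U2 e']]]].
apply/(HfinP hM q_gt1 x0); split; first exact: cLp1_lin.
exists (fun y => complex.Re z * f1 y + (- complex.Im z * f2 y + g1 y)).
exists (fun y => complex.Re z * f2 y + (complex.Im z * f1 y + g2 y)).
split; [by do 2 apply: Lq0_linear => //|by do 2 apply: Lq0_linear => //|].
apply: filterS2 e e' => y /(_ I) -> /(_ I) -> _.
rewrite {1}(complexRI z).
by apply/eqP; rewrite eq_complex !(ReD, ImD, ReM, ImM)/=; apply/andP; split;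
  apply/eqP; ring.
Qed.

Lemma Lq0_Hfin (f : M -> R) : V f -> Hfin rho mu q (fun y => (f y)%:C).
Proof.
move=> Vf; have [Wf _] := Vf; apply/(HfinP hM q_gt1 x0); split.
  apply/cL1P; split => /=; first exact: (Lq_integrable hM q_gt1 Wf).
  exact: integrable0.
have V0 : V (cst 0).
  have := Lq0_linear hM q_gt1 (-1) Vf Vf.
  by congr (V _); apply/funext => x; rewrite mulN1r addNr.
exists f, (cst 0); split => //.
by apply: aeW => x _; rewrite mulr0 addr0.
Qed.

(* Apply the functional bound to [h |-> int s p(T h)], [s] the sign of [p(T f)]. *)
Let part_bound (p : R[i] -> R) (f : M -> R) (c : R) :
  (forall (x : R) z w, p (x%:C * z + w) = x * p z + p w) ->
  (forall z, `|p z| <= cabs z) ->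
  (forall g, cLp mu 1%E g -> mu.-integrable setT (EFin \o (p \o g))) ->
  V f -> test_norm_le (fun y => (f y)%:C) c ->
  (\int[mu]_x `|p (T (fun y => (f y)%:C) x)|%:E <= (8 * A * c)%:E)%E.
Proof.
move=> p_lin pc pi Vf fc.
have LT (h : M -> R) : V h -> cLp mu 1%E (T (fun y => (h y)%:C)).
  by move=> Vh; apply: (lin_L1 T_linear); exact: Lq0_Hfin.
pose tf := T (fun y => (f y)%:C).
pose s x := Num.sg (p (tf x)).
have mpt : measurable_fun setT (p \o tf).
  by have /integrableP[/measurable_EFinP] := pi _ (LT _ Vf).
have ms : measurable_fun setT s by exact: measurable_fun_sgr.
have s1 x : `|s x| <= 1 by rewrite /s normr_sg; case: (_ != _).
pose u (h : M -> R) := \int[mu]_x (s x * p (T (fun y => (h y)%:C) x)).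
have mp (h : M -> R) : V h -> measurable_fun setT (fun x => p (T (fun y => (h y)%:C) x)).
  by move=> Vh; have /integrableP[/measurable_EFinP] := pi _ (LT _ Vh).
have ui (h : M -> R) : V h ->
    mu.-integrable setT (fun x => (s x * p (T (fun y => (h y)%:C) x))%:E).
  move=> Vh; have hi := pi _ (LT _ Vh).
  apply: (@le_integrable _ _ _ mu setT measurableT _ _ _ _ hi).
    by apply/measurable_EFinP; apply: measurable_funM => //; exact: mp.
  move=> x _; rewrite !abse_EFin lee_fin normrM ler_piMl//.
have u_ae (h k : M -> R) : V h -> V k -> {ae mu, forall x, h x = k x} -> u h = u k.
  move=> Vh Vk hk; rewrite /u /Rintegral; congr fine; apply: ae_eq_integral => //.
  - by case/integrableP: (ui _ Vh).
  - by case/integrableP: (ui _ Vk).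
  - have /filterS : T (fun y => (h y)%:C) = T (fun y => (k y)%:C) %[ae mu].
      apply: (lin_ae T_linear); [exact: Lq0_Hfin|exact: Lq0_Hfin|].
      by apply: filterS hk => x -> _.
    by apply => x /[apply] ->.
have u_lin (e : R) (h k : M -> R) : V h -> V k ->
    u (fun x => e * h x + k x) = e * u h + u k.
  move=> Vh Vk; rewrite /u -RintegralZl//; last exact: ui.
  rewrite -RintegralD//; [|exact: (integrableZl measurableT e (ui _ Vh))|exact: ui].
  have Vhk := Lq0_linear hM q_gt1 e Vh Vk.
  rewrite /Rintegral; congr fine; apply: ae_eq_integral => //.
  - by case/integrableP: (ui _ Vhk).
  - apply/measurable_EFinP; apply: measurable_funD; last first.
      by apply: measurable_funM => //; exact: mp.
    by apply: measurable_funM => //; apply: measurable_funM => //; exact: mp.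
  - have /filterS : T (fun y => (e * h y + k y)%:C) =
        (fun x => e%:C * T (fun y => (h y)%:C) x + T (fun y => (k y)%:C) x) %[ae mu].
      have := lin_linear T_linear e%:C (Lq0_Hfin Vh) (Lq0_Hfin Vk).
      suff -> : (fun x => e%:C * (h x)%:C + (k x)%:C) = (fun y => (e * h y + k y)%:C) by [].
      by apply/funext => x; rewrite rmorphD rmorphM.
    by apply => x /[apply] ->; rewrite p_lin; congr EFin; ring.
have u_atom (a : M -> R) : V a -> atom rho mu q (fun y => (a y)%:C) -> `|u a| <= A.
  move=> Va aa; rewrite -lee_fin EFin_normr_Rintegral//; last exact: ui.
  apply: (le_trans (le_abse_integral _ _ _)) => //; first by case/integrableP: (ui _ Va).
  apply: le_trans (T_atom aa); rewrite cLnorm1E; apply: ge0_le_integral => //.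
  - by apply: measurableT_comp => //; case/integrableP: (ui _ Va).
  - by apply: measurable_cabs; case: (LT _ Va).
  - move=> x _; rewrite abse_EFin lee_fin normrM.
    by rewrite (le_trans _ (pc _))// ler_piMl.
have := functional_le_bounded_tests hM mu_sfin q_gt1 A_gt0 u_lin u_ae u_atom (K := c) Vf.
move=> h; have {h}uf : `|u f| <= 8 * A * c.
  by apply: h => beta mb bb ba; have [] := fc beta (And3 mb bb ba).
have -> : (\int[mu]_x `|p (T (fun y => (f y)%:C) x)|%:E)%E = (u f)%:E.
  rewrite /u /Rintegral fineK; last by apply: integrable_fin_num => //; exact: ui.
  by apply: eq_integral => x _; rewrite normrEsg.
by rewrite lee_fin (le_trans (ler_norm _)).
Qed.

(** [32 = 8 * 2 * 2]: one factor 2 for the two parts of [T f] with [f] real, one for writing [g] as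
    [f1 + 'i f2]. The constant [c] is the same for [f1] and [f2], because tests treat the parts of
    [g] separately. *)
Lemma operator_bound g (c : R) : Hfin rho mu q g -> test_norm_le g c ->
  (cLnorm mu 1 (T g) <= (32 * A * c)%:E)%E.
Proof.
move=> Hg gc; have /(HfinP hM q_gt1 x0)[Lg [f1 [f2 [V1 V2 e]]]] := Hg.
have L1 := Lq0_Hfin V1; have L2 := Lq0_Hfin V2.
have T1 := lin_L1 T_linear L1; have T2 := lin_L1 T_linear L2.
have H12 := Hfin_lin 'i L2 L1.
have e' : g = (fun x => 'i * (f2 x)%:C + (f1 x)%:C) %[ae mu].
  by apply: filterS e => x /[apply] ->; rewrite addrC.
have Te : T g = (fun x => 'i * T (fun y => (f2 y)%:C) x + T (fun y => (f1 y)%:C) x) %[ae mu].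
  apply: ae_eq_trans (lin_linear T_linear 'i L2 L1).
  exact: (lin_ae T_linear).
have [mg _] := Lg; have [[[m1 _ _] _] [[m2 _ _] _]] := (V1, V2).
have c0 : test_norm_le (fun y => (f1 y)%:C) c /\ test_norm_le (fun y => (f2 y)%:C) c.
  have gc' := test_norm_le_ae mg (cmeasurable_lin 'i (cmeasurable_real m2)
    (cmeasurable_real m1)) e' gc.
  have zero beta : `|\int[mu]_x (0 * beta x : R)| = 0.
    by under eq_Rintegral do rewrite mul0r; rewrite Rintegral_cst// mul0r normr0.
  split => beta tb; have [h1 h2] := gc' beta tb.
    split; last by rewrite /= zero (le_trans _ h1).
    apply: le_trans h1; rewrite le_eqVlt; apply/orP; left; apply/eqP; congr (`| _ |).
    by apply: eq_Rintegral => x _; rewrite ReD ReM/=; ring.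
  split; last by rewrite /= zero (le_trans _ h1).
  apply: le_trans h2; rewrite le_eqVlt; apply/orP; left; apply/eqP; congr (`| _ |).
  by apply: eq_Rintegral => x _; rewrite ImD ImM/=; ring.
have [c1 c2] := c0.
have real_bound (f : M -> R) : V f -> test_norm_le (fun y => (f y)%:C) c ->
    (cLnorm mu 1 (T (fun y => (f y)%:C)) <= (16 * A * c)%:E)%E.
  move=> Vf fc; have LT := lin_L1 T_linear (Lq0_Hfin Vf).
  have bR : (\int[mu]_x `|complex.Re (T (fun y => (f y)%:C) x)|%:E <= (8 * A * c)%:E)%E.
    apply: part_bound => //; last by move=> h /cL1P[].
      by move=> x z w; rewrite ReD ReM/= mul0r subr0.
    exact: normr_Re_le.
  have bI : (\int[mu]_x `|complex.Im (T (fun y => (f y)%:C) x)|%:E <= (8 * A * c)%:E)%E.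
    apply: part_bound => //; last by move=> h /cL1P[].
      by move=> x z w; rewrite ImD ImM/= mul0r addr0.
    exact: normr_Im_le.
  have -> : (16 * A * c)%:E = ((8 * A * c)%:E + (8 * A * c)%:E)%E.
    by rewrite -EFinD; congr EFin; ring.
  apply: le_trans (leeD bR bI); have [mT _] := LT; have [mR mI] := mT.
  have mR' : measurable_fun setT (fun x => `|complex.Re (T (fun y => (f y)%:C) x)|%:E : \bar R).
    by apply/measurable_EFinP; exact: measurableT_comp.
  have mI' : measurable_fun setT (fun x => `|complex.Im (T (fun y => (f y)%:C) x)|%:E : \bar R).
    by apply/measurable_EFinP; exact: measurableT_comp.
  rewrite cLnorm1E -ge0_integralD//; apply: ge0_le_integral => //.
  - by move=> x _; rewrite lee_fin cabs_ge0.
  - exact: measurable_cabs.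
  - exact: emeasurable_funD.
  - by move=> x _; rewrite -EFinD lee_fin cabs_le.
have [mT1 _] := T1; have [mT2 _] := T2; have [mT _] := lin_L1 T_linear Hg.
rewrite (cLnorm1_ae mT (cmeasurable_lin 'i mT2 mT1) Te).
apply: (le_trans (cLnorm1_lin mu 'i mT2 mT1)).
have -> : cabs ('i : R[i]) = 1 by rewrite /cabs /= expr0n add0r expr1n sqrtr1.
rewrite mul1e; have -> : (32 * A * c)%:E = ((16 * A * c)%:E + (16 * A * c)%:E)%E.
  by rewrite -EFinD; congr EFin; ring.
by apply: leeD; exact: real_bound.
Qed.

End operator_bound.
End bounded_tests.

(** * Extension by continuity *)

Section extension.
Context {R : realType} {d : measure_display} {M : measurableType d}.
Context {rho : M -> M -> R} {mu : {measure set M -> \bar R}}.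
Hypothesis hM : homogeneous_type rho mu.
Hypothesis mu_sfin : sigma_finite setT mu.
Context {q : R}.
Hypothesis q_gt1 : 1 < q.
Variable x0 : M.
Implicit Types f g h : M -> R[i].
Variables (T : (M -> R[i]) -> M -> R[i]) (A : R).
Hypothesis T_linear : linear_to_L1 mu (Hfin rho mu q) T.
Hypothesis A_gt0 : 0 < A.
Hypothesis T_atom : forall a, atom rho mu q a -> (cLnorm mu 1 (T a) <= A%:E)%E.

Local Notation N := (@test_norm_le R d M rho mu q x0).
Local Notation Hfin := (Hfin rho mu q).

(* [F] is a value at [f] of the extension of [T] by continuity. *)
Definition extends f F : Prop := [/\ cLp mu 1%E f, cLp mu 1%E F &
  exists h : nat -> M -> R[i], [/\ forall n, Hfin (h n),
    forall e, 0 < e -> \forall n \near \oo, N (fun x => f x - h n x) e &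
    cLnorm mu 1 (fun x => F x - T (h n) x) @[n --> \oo] --> 0%E]].

Let LHfin h : Hfin h -> cLp mu 1%E h.
Proof. by case. Qed.

Let LT h : Hfin h -> cLp mu 1%E (T h).
Proof. by move=> Hh; exact: (lin_L1 T_linear Hh). Qed.

Let Hfin_sub g h : Hfin g -> Hfin h -> Hfin (fun x => g x - h x).
Proof.
move=> Hg Hh; have := Hfin_lin hM q_gt1 x0 (-1) Hh Hg.
by congr Hfin; apply/funext => x; rewrite mulN1r addrC.
Qed.

Let T_sub g h : Hfin g -> Hfin h ->
  T (fun x => g x - h x) = (fun x => T g x - T h x) %[ae mu].
Proof.
move=> Hg Hh; have := lin_linear T_linear (-1) Hh Hg.
have -> : (fun x => -1 * h x + g x) = (fun x => g x - h x).
  by apply/funext => x; rewrite mulN1r addrC.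
by apply: filterS => x /[apply] ->; rewrite mulN1r addrC.
Qed.

Let cLnorm1_T_sub g h (c : R) : Hfin g -> Hfin h -> N (fun x => g x - h x) c ->
  (cLnorm mu 1 (fun x => T g x - T h x)%R <= (32 * A * c)%:E)%E.
Proof.
move=> Hg Hh gh; have Hgh := Hfin_sub Hg Hh.
have := operator_bound hM q_gt1 mu_sfin T_linear A_gt0 T_atom Hgh gh.
rewrite (cLnorm1_ae (cLp1_measurable (LT Hgh))
  (cmeasurable_sub (cLp1_measurable (LT Hg)) (cLp1_measurable (LT Hh))))//.
exact: T_sub.
Qed.

(** Two sequences approximating the same function for [N] are [N]-close to each other, and
    [operator_bound] makes their images under [T] close in L^1. *)
Lemma extends_unique f f' F F' : f = f' %[ae mu] -> extends f F ->
  extends f' F' -> F = F' %[ae mu].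
Proof.
move=> ff' [Lf LF [h [Hh hf hF]]] [Lf' LF' [h' [Hh' hf' hF']]].
apply: cLnorm1_sub_eq0 => //; [exact: (cLp1_measurable LF)|exact: (cLp1_measurable LF')|].
apply/eqP; rewrite eq_le cLnorm_ge0 andbT; apply/lee_addgt0Pr => e e0; rewrite add0e.
have e3 : 0 < e / 4 by rewrite divr_gt0.
(* By [test_norm_le_sub] the two approximations differ by [2 * e' + e']; [operator_bound] multiplies
   this by [32 * A], and the choice of [e'] makes the product [e / 2]. *)
pose e' := e / (2 * (32 * A * 3)).
have e'0 : 0 < e' by rewrite divr_gt0// !mulr_gt0.
near \oo => n.
have n1 : N (fun x => f x - h n x) e' by near: n; exact: hf.
have n2 : N (fun x => f' x - h' n x) e' by near: n; exact: hf'.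
have n3 : (cLnorm mu 1 (fun x => F x - T (h n) x)%R <= (e / 4)%:E)%E.
  by near: n; exact: cvg0_ereal_near.
have n4 : (cLnorm mu 1 (fun x => F' x - T (h' n) x)%R <= (e / 4)%:E)%E.
  by near: n; exact: cvg0_ereal_near.
have mf := cLp1_measurable Lf; have mf' := cLp1_measurable Lf'.
have mh k := cLp1_measurable (LHfin (Hh k)).
have mh' k := cLp1_measurable (LHfin (Hh' k)).
have n2' : N (fun x => f x - h' n x) e'.
  apply: test_norm_le_ae n2; try exact: cmeasurable_sub.
  by apply: filterS ff' => x /[apply] ->.
have n5 : N (fun x => h n x - h' n x) (3 * e').
  have := test_norm_le_sub Lf (LHfin (Hh n)) (LHfin (Hh' n)) n1 n2'.
  by rewrite (_ : 2 * e' + e' = 3 * e'); last ring.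
have n6 := cLnorm1_T_sub (Hh n) (Hh' n) n5.
have mF := cLp1_measurable LF; have mF' := cLp1_measurable LF'.
have mT k := cLp1_measurable (LT (Hh k)).
have mT' k := cLp1_measurable (LT (Hh' k)).
apply: (le_trans (cLnorm1_sub_le mu mF mF' (mT n))).
have -> : e%:E = ((e / 4)%:E + ((e / 4)%:E + (32 * A * (3 * e'))%:E))%E.
  rewrite -!EFinD; congr EFin; rewrite /e'; field.
  by rewrite gt_eqF.
apply: leeD => //; apply: le_trans (leeD n4 n6).
exact: cLnorm1_sub_le.
Unshelve. all: by end_near. Qed.

Lemma extends_lin (c : R[i]) f g F G : extends f F -> extends g G ->
  extends (fun x => c * f x + g x) (fun x => c * F x + G x).
Proof.
move=> [Lf LF [h [Hh hf hF]]] [Lg LG [k [Hk kg kG]]].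
split; [exact: cLp1_lin|exact: cLp1_lin|].
exists (fun n x => c * h n x + k n x); split.
- by move=> n; exact: (Hfin_lin hM q_gt1 x0).
- move=> e e0; have c1 : 0 < 2 * cabs c + 1 by rewrite ltr_wpDl// mulr_ge0// cabs_ge0.
  have e' : 0 < e / (2 * cabs c + 1) by rewrite divr_gt0.
  apply: filterS2 (hf _ e') (kg _ e') => n h1 h2.
  have := test_norm_le_lin c (cLp1_sub Lf (LHfin (Hh n)))
    (cLp1_sub Lg (LHfin (Hk n))) h1 h2.
  rewrite (_ : 2 * cabs c * _ + _ = e); last by field; rewrite gt_eqF.
  by congr (N _ _); apply/funext => x; ring.
- apply: near_cvg0_ereal => [n|e e0]; first exact: cLnorm_ge0.
  have c1 : 0 < cabs c + 1 by rewrite ltr_wpDl// cabs_ge0.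
  have e' : 0 < e / (cabs c + 1) by rewrite divr_gt0.
  apply: filterS2 (cvg0_ereal_near hF e') (cvg0_ereal_near kG e') => n h1 h2.
  have Hn := Hfin_lin hM q_gt1 x0 c (Hh n) (Hk n).
  have mF := cLp1_measurable LF; have mG := cLp1_measurable LG.
  have mT1 := cLp1_measurable (LT (Hh n)); have mT2 := cLp1_measurable (LT (Hk n)).
  rewrite (@cLnorm1_ae _ _ _ _ _ (fun x => c * (F x - T (h n) x) + (G x - T (k n) x))).
  + apply: (le_trans (cLnorm1_lin mu c (cmeasurable_sub mF mT1) (cmeasurable_sub mG mT2))).
    rewrite (_ : e = cabs c * (e / (cabs c + 1)) + e / (cabs c + 1)); last first.
      by field; rewrite gt_eqF.
    rewrite EFinD EFinM leeD// lee_wpmul2l// lee_fin cabs_ge0//.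
  + apply: cmeasurable_sub; first exact: cmeasurable_lin.
    exact: (cLp1_measurable (LT Hn)).
  + by apply: cmeasurable_lin; exact: cmeasurable_sub.
  + have := lin_linear T_linear c (Hh n) (Hk n).
    by apply: filterS => x /[apply] ->; ring.
Qed.

Lemma extends_Hfin f : Hfin f -> extends f (T f).
Proof.
move=> Hf; split; [exact: LHfin|exact: LT|].
exists (fun=> f); split => //.
- move=> e e0; apply: nearW => n beta tb; split.
    under eq_Rintegral do rewrite subrr mul0r.
    by rewrite Rintegral_cst// mul0r normr0 ltW.
  under eq_Rintegral do rewrite subrr mul0r.
  by rewrite Rintegral_cst// mul0r normr0 ltW.
- rewrite (_ : (fun _ => _) = cst 0%E); first exact: cvg_cst.
  apply/funext => n; rewrite cLnorm1E integral0_eq// => x _.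
  by rewrite subrr cabs_real normr0.
Qed.

(** * Partial sums and tails of an atomic decomposition *)

Section decomposition.
Variables (lam : nat -> R[i]) (a : nat -> M -> R[i]) (g : M -> R[i]).
Hypothesis Lg : cLp mu 1%E g.
Hypothesis g_lam : atomic_decomposition rho mu q g lam a.

Let S n x := \sum_(0 <= j < n) lam j * a j x.
Let sigma n : R := \sum_(0 <= j < n) cabs (lam j).
Let Lam : R := fine (\sum_(0 <= j <oo) (cabs (lam j))%:E)%E.

Let aa j : atom rho mu q (a j).
Proof. by case: g_lam. Qed.

Let Ha j : Hfin (a j).
Proof.
have [a1 [a2 [V1 V2 _ _ e]]] := atom_Re_Im hM q_gt1 x0 (aa j).
apply/(HfinP hM q_gt1 x0); split; last by exists a1, a2.
have V12 := Hfin_lin hM q_gt1 x0 'i (Lq0_Hfin hM q_gt1 V2) (Lq0_Hfin hM q_gt1 V1).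
have /(atomP hM q_gt1)[_ [_ [_ [ma _ _ _]]]] := aa j.
split => //; have [mV Vy] := LHfin V12.
rewrite (cLnorm1_ae ma mV)//.
by apply: filterS e => x /[apply] ->; rewrite addrC.
Qed.

Let SS n x : S n.+1 x = lam n * a n x + S n x.
Proof. by rewrite /S big_nat_recr//= addrC. Qed.

Let HS n : Hfin (S n).
Proof.
elim: n => [|n ih].
  have := Hfin_sub (Ha 0) (Ha 0); congr Hfin; apply/funext => x.
  by rewrite subrr /S big_nil.
have := Hfin_lin hM q_gt1 x0 (lam n) (Ha n) ih.
by congr Hfin; apply/funext => x; rewrite SS.
Qed.

(** Each new term costs [2 * cabs (lam j)]: an atom has [N] at most 1, and a complex coefficient
    costs a factor 2. *)
Let NS n m : (n <= m)%N -> N (fun x => S m x - S n x) (2 * (sigma m - sigma n)).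
Proof.
move=> /subnK <-; elim: (m - n)%N => [|k ih].
  move=> beta tb; rewrite add0n subrr mulr0.
  by split; under eq_Rintegral do rewrite subrr mul0r;
    rewrite Rintegral_cst// mul0r normr0.
rewrite addSn.
have := test_norm_le_lin (lam (k + n)%N) (LHfin (Ha _))
  (cLp1_sub (LHfin (HS (k + n))) (LHfin (HS n))) (test_norm_le_atom hM q_gt1 (aa _)) ih.
have -> : (fun x => S (k + n).+1 x - S n x) =
    (fun x => lam (k + n)%N * a (k + n)%N x + (S (k + n)%N x - S n x)).
  by apply/funext => x; rewrite SS addrA.
suff -> : 2 * (sigma (k + n).+1 - sigma n) =
    2 * cabs (lam (k + n)%N) * 1 + 2 * (sigma (k + n)%N - sigma n) by [].
by rewrite /sigma big_nat_recr//=; ring.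
Qed.

Let sum_fin : (\sum_(0 <= j <oo) (cabs (lam j))%:E = Lam%:E)%E.
Proof.
rewrite /Lam fineK// ge0_fin_numE; first by case: g_lam.
by apply: nneseries_ge0 => n _ _; rewrite lee_fin cabs_ge0.
Qed.

Let sigma_le n : sigma n <= Lam.
Proof.
rewrite -lee_fin -sum_fin /sigma -sumEFin.
by apply: nneseries_lim_ge => k _ _; rewrite lee_fin cabs_ge0.
Qed.

Let sigma_cvg : sigma n @[n --> \oo] --> Lam.
Proof.
have : (\sum_(0 <= j < n) (cabs (lam j))%:E)%E @[n --> \oo] --> Lam%:E.
  rewrite -sum_fin; apply: is_cvg_nneseries => n _ _.
  by rewrite lee_fin cabs_ge0.
by under eq_fun do rewrite sumEFin; move/fine_cvgP => [].
Qed.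

Lemma partial_sum_Hfin n : Hfin (S n). Proof. exact: HS. Qed.

(** Let [m] tend to infinity in [NS] with [n] fixed. The decomposition converges in L^1 only, which
    is why [test_norm_le_limit] is needed. *)
Lemma partial_sum_test n : N (fun x => g x - S n x) (2 * (Lam - sigma n)).
Proof.
apply: (@test_norm_le_limit _ _ _ _ _ _ _ (fun m x => S m x - S n x)).
- by move=> m; apply: cLp1_sub; exact: LHfin.
- by apply: cLp1_sub => //; exact: LHfin.
- have [_ _] := g_lam; apply: cvg_trans; apply: near_eq_cvg; apply: nearW => m /=.
  by congr cLnorm; apply/funext => x; rewrite /S; ring.
- near=> m; have nm : (n <= m)%N by near: m; exact: nbhs_infty_ge.
  move=> beta tb; have [h1 h2] := NS nm tb.
  by split; [apply: (le_trans h1)|apply: (le_trans h2)]; rewrite ler_wpM2l// lerD2r.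
Unshelve. all: by end_near. Qed.

Lemma tail_small (e : R) : 0 < e -> \forall n \near \oo, 2 * (Lam - sigma n) <= e.
Proof.
move=> e0; have e2 : 0 < e / 2 by rewrite divr_gt0.
have /cvgrPdist_le/(_ _ e2) := sigma_cvg; apply: filterS => n h.
have := le_trans (ler_norm _) h; rewrite ler_pdivlMr//; lra.
Qed.

Lemma partial_sum_test_small (e : R) : 0 < e ->
  \forall n \near \oo, N (fun x => g x - S n x) e.
Proof.
move=> /tail_small; apply: filterS => n le_e beta tb.
by have [h1 h2] := partial_sum_test n tb; split; [apply: (le_trans h1)|apply: (le_trans h2)].
Qed.

(** The increments of [T] along the partial sums are at most [64 * A * cabs (lam n)] in L^1, with 32
    from [operator_bound] and 2 from [NS]; hence their series converges in L^1. *)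
Lemma extends_decomposition : exists2 F, extends g F &
  (cLnorm mu 1 F <= (64 * A * Lam)%:E)%E.
Proof.
pose D n x := T (S n.+1) x - T (S n) x.
have LD n : cLp mu 1%E (D n) by apply: cLp1_sub; exact: LT.
have Dle n : (cLnorm mu 1 (D n) <= (64 * A * cabs (lam n))%:E)%E.
  have := cLnorm1_T_sub (HS n.+1) (HS n) (NS (leqnSn n)).
  rewrite (_ : 32 * A * _ = 64 * A * cabs (lam n))//.
  by rewrite /sigma big_nat_recr//=; ring.
have Dy : (\sum_(0 <= n <oo) cLnorm mu 1 (D n) < +oo)%E.
  apply: (@le_lt_trans _ _ (\sum_(0 <= n <oo) (64 * A)%:E * (cabs (lam n))%:E)%E).
    apply: lee_nneseries => [n _ _|n _]; first exact: cLnorm_ge0.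
    by rewrite -EFinM.
  rewrite nneseriesZl; last by move=> n _; rewrite lee_fin cabs_ge0.
  by rewrite sum_fin -EFinM ltry.
have [F0 [LF0 F0cvg]] := L1_series_complete LD Dy.
(* The telescoping sum starts from [T (S 0)]. Although [S 0] is the zero function, its image is only
   zero almost everywhere, so it is kept. *)
pose F x := F0 x + T (S 0) x.
have LF : cLp mu 1%E F.
  have := cLp1_lin 1 LF0 (LT (HS 0)).
  by congr (cLp _ _ _); apply/funext => x; rewrite mul1r.
have Fcvg : cLnorm mu 1 (fun x => F x - T (S n) x) @[n --> \oo] --> 0%E.
  apply: cvg_trans F0cvg; apply: near_eq_cvg; apply: nearW => n /=.
  congr cLnorm; apply/funext => x; rewrite /F.
  by rewrite (telescope_sumr (fun j => T (S j) x))//; ring.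
exists F.
  split => //; exists S; split => //.
  exact: partial_sum_test_small.
apply/lee_addgt0Pr => e e0.
near \oo => n.
have h : (cLnorm mu 1 (fun x => F x - T (S n) x)%R <= e%:E)%E.
  by near: n; exact: cvg0_ereal_near.
(* [operator_bound] is applied to the whole partial sum, for which [NS] from index 0 gives [N] at
   most [2 * Lam]; the bound then passes to [F]. *)
have TS : (cLnorm mu 1 (T (S n)) <= (64 * A * Lam)%:E)%E.
  have NSn : N (S n) (2 * Lam).
    move=> beta tb; have [h1 h2] := NS (leq0n n) tb.
    have -> : S n = (fun x => S n x - S 0 x).
      by apply/funext => x; rewrite {3}/S big_nil subr0.
    have le0 : 2 * (sigma n - sigma 0) <= 2 * Lam.
      by rewrite ler_wpM2l// {2}/sigma big_nil subr0.
    by split; [apply: (le_trans h1)|apply: (le_trans h2)].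
  have := operator_bound hM q_gt1 mu_sfin T_linear A_gt0 T_atom (HS n) NSn.
  by rewrite (_ : 32 * A * (2 * Lam) = 64 * A * Lam); last ring.
apply: (le_trans (cLnorm1_le mu (cLp1_measurable LF) (cLp1_measurable (LT (HS n))))).
by rewrite addeC; exact: leeD.
Unshelve. all: by end_near. Qed.

(** Only the coefficients are set to 0 beyond [n]; the functions [a] are kept, so that all terms
    remain atoms. Uniqueness needs this, since a competing extension is linear on H^1 only. *)
Lemma H1_partial_sum n : H1 rho mu q (S n).
Proof.
split; first exact: LHfin.
exists (fun j => if (j < n)%N then lam j else 0), a; split.
- exact: aa.
- apply: (@le_lt_trans _ _ (\sum_(0 <= j <oo) (cabs (lam j))%:E)%E).
    apply: lee_nneseries => [j _ _|j _]; first by rewrite lee_fin cabs_ge0.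
    by rewrite lee_fin; case: ifP => // _; rewrite cabs_real normr0 cabs_ge0.
  by rewrite sum_fin ltry.
- apply: cvg_near_cst; near=> m.
  have nm : (n <= m)%N by near: m; exact: nbhs_infty_ge.
  rewrite cLnorm1E integral0_eq// => x _.
  rewrite (_ : \sum_(0 <= j < m) _ = S n x) ?subrr ?cabs_real ?normr0//.
  rewrite (big_cat_nat (leq0n n) nm)/= [X in _ + X](_ : _ = 0).
    by rewrite addr0 /S; apply: eq_big_nat => j /andP[_ ->].
  rewrite big_nat_cond big1// => j /andP[/andP[nj _] _].
  by rewrite ltnNge nj mul0r.
Unshelve. all: by end_near. Qed.

(** The decomposition shifted by [n] represents the tail. Its coefficient sum makes a bounded
    operator on H^1 small on tails. *)
Lemma H1_tail n : H1 rho mu q (fun x => g x - S n x) /\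
  (H1norm rho mu q (fun x => g x - S n x)%R <= (Lam - sigma n)%:E)%E.
Proof.
have dec : atomic_decomposition rho mu q (fun x => g x - S n x)
    (fun j => lam (j + n)%N) (fun j => a (j + n)%N) /\
    (\sum_(0 <= j <oo) (cabs (lam (j + n)%N))%:E = (Lam - sigma n)%:E)%E.
  have sumE : (\sum_(0 <= j <oo) (cabs (lam (j + n)%N))%:E = (Lam - sigma n)%:E)%E.
    apply/cvg_lim => //.
    have -> : (fun k => \sum_(0 <= j < k) (cabs (lam (j + n)%N))%:E)%E =
        (fun k => (sigma (k + n)%N - sigma n)%:E).
      apply/funext => k; rewrite sumEFin; congr EFin.
      rewrite /sigma (big_cat_nat (leq0n n) (leq_addl k n))/= [X in _ = X - _]addrC addrK.
      by rewrite -{2}(add0n n) big_addn addnK.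
    apply: cvg_EFin; first exact: nearW.
    by apply: cvgB; [rewrite (cvg_shiftn n sigma) | exact: cvg_cst].
  split; last exact: sumE.
  split.
  - by move=> j; exact: aa.
  - by rewrite sumE ltry.
  - have [_ _] := g_lam; rewrite -(cvg_shiftn n).
    apply: cvg_trans; apply: near_eq_cvg; apply: nearW => k /=.
    congr cLnorm; apply/funext => x.
    rewrite (big_cat_nat (leq0n n) (leq_addl k n))/= opprD addrA; congr (_ - _).
    by rewrite -{1}(add0n n) big_addn addnK.
split.
  split; first by apply: cLp1_sub => //; exact: LHfin.
  by eexists; eexists; exact: dec.1.
by apply: ereal_inf_lbound; eexists; eexists; split; [exact: dec.1 | rewrite dec.2].
Qed.

End decomposition.
End extension.

Theorem theorem4p1 (R : realType) (d : measure_display) (M : measurableType d)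
    (rho : M -> M -> R) (mu : {measure set M -> \bar R})
    (hM : homogeneous_type rho mu)
    (mu_sfin : sigma_finite setT mu)
    (mu_infty : mu setT = +oo%E)
    (q : R) (q_gt1 : 1 < q)
    (T : (M -> R[i]) -> (M -> R[i]))
    (T_lin : linear_to_L1 mu (Hfin rho mu q) T)
    (T_atoms : (ereal_sup [set cLnorm mu 1%E (T a) | a in atom rho mu q]
                  < +oo)%E) :
  exists S : (M -> R[i]) -> (M -> R[i]),
    bounded_extension rho mu q T S /\
    forall S' : (M -> R[i]) -> (M -> R[i]),
      bounded_extension rho mu q T S' ->
      forall f, H1 rho mu q f -> S' f = S f %[ae mu].
Proof.
(* An empty space would have measure 0; a point is needed as the centre of the exhausting balls. *)
have [x0 _] : exists x : M, True.
  apply: contrapT => noM; have M0 : [set: M] = set0.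
    by apply/seteqP; split => // x _; apply: noM; exists x.
  by move: mu_infty; rewrite M0 measure0.
pose sup := ereal_sup [set cLnorm mu 1%E (T a) | a in atom rho mu q].
(* The maximum with 1 keeps [A] positive even when [T] annihilates every atom. *)
pose A := Num.max 1 (fine sup).
have A0 : 0 < A by rewrite lt_max ltr01.
have T_atom a : atom rho mu q a -> (cLnorm mu 1 (T a) <= A%:E)%E.
  move=> aa; have le_sup : (cLnorm mu 1 (T a) <= sup)%E.
    by apply: ereal_sup_ubound; exists a.
  apply: (le_trans le_sup); rewrite -[leLHS]fineK.
    by rewrite lee_fin le_max lexx orbT.
  by rewrite ge0_fin_numE// (le_trans _ le_sup)// cLnorm_ge0.
pose ext := @extends R d M rho mu q x0 T.
(* A representative of the extension is chosen for each [f] separately, so linearity and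
   compatibility hold a.e., through [extends_unique]. The fallback value [f] is only taken where no
   extension value exists, which does not happen on H^1. *)
pose S f := if pselect (exists F, ext f F) is left h then sval (cid h) else f.
have SP f F : ext f F -> ext f (S f).
  by move=> fF; rewrite /S; case: pselect => [h|[]]; [case: cid | exists F].
have ext_H1 f lam a : cLp mu 1%E f -> atomic_decomposition rho mu q f lam a ->
    exists2 F, ext f F & (cLnorm mu 1 F <=
      (64 * A * fine (\sum_(0 <= j <oo) (cabs (lam j))%:E)%E)%:E)%E.
  by move=> Lf dec; exact: (extends_decomposition hM mu_sfin q_gt1 x0 T_lin A0 T_atom Lf dec).
have SH1 f : H1 rho mu q f -> ext f (S f).
  by move=> [Lf [lam [a dec]]]; have [F fF _] := ext_H1 _ _ _ Lf dec; exact: SP fF.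
have uniq := extends_unique hM mu_sfin q_gt1 T_lin A0 T_atom (x0 := x0).
have sum_fin f lam a : atomic_decomposition rho mu q f lam a ->
    ((fine (\sum_(0 <= j <oo) (cabs (lam j))%:E))%:E =
     \sum_(0 <= j <oo) (cabs (lam j))%:E)%E.
  move=> [_ lamy _]; rewrite fineK// ge0_fin_numE//.
  by apply: nneseries_ge0 => n _ _; rewrite lee_fin cabs_ge0.
exists S; split.
  split.
  - split.
    + by move=> f /SH1[].
    + by move=> f g /SH1 Sf /SH1 Sg fg; exact: uniq fg Sf Sg.
    + move=> c f g /SH1 Sf /SH1 Sg.
      have e := extends_lin hM q_gt1 T_lin c Sf Sg.
      by apply: (uniq _ _ _ _ _ (SP _ _ e) e); exact: ae_eq_refl.
  - exists (64 * A) => f Hf; have A64 : 0 < 64 * A by exact: mulr_gt0.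
    (* Every decomposition of [f] yields its own extension value [F], equal a.e. to [S f]; so the
       bound holds for each coefficient sum and hence for their infimum. *)
    rewrite -lee_pdivrMl//; apply: le_ereal_inf_tmp => s [lam [a [dec ->]]].
    have [Lf _] := Hf; have [F fF Fle] := ext_H1 _ _ _ Lf dec.
    have [_ LSf _] := SH1 _ Hf; have [_ LF _] := fF.
    rewrite lee_pdivrMl// -(sum_fin _ _ _ dec) -EFinM.
    rewrite (cLnorm1_ae (cLp1_measurable LSf) (cLp1_measurable LF))//.
    by apply: (uniq _ _ _ _ _ (SH1 _ Hf) fF); exact: ae_eq_refl.
  - move=> f Hf; have e := extends_Hfin x0 T_lin Hf.
    by apply: (uniq _ _ _ _ _ (SP _ _ e) e); exact: ae_eq_refl.
move=> S' [S'_lin [C S'_bd] S'_ext] f Hf; have [Lf [lam [a dec]]] := Hf.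
pose s n x := \sum_(0 <= j < n) lam j * a j x.
have Hs n : Hfin rho mu q (s n) := partial_sum_Hfin hM q_gt1 x0 dec n.
have LS'f := lin_L1 S'_lin Hf.
(* It suffices that [S' f] is itself a limit of [T] along the partial sums; [extends_unique] then
   identifies it with [S f]. *)
suff e : ext f (S' f) by apply: (uniq _ _ _ _ _ e (SH1 _ Hf)); exact: ae_eq_refl.
split => //; exists s; split => //.
  exact: (partial_sum_test_small hM q_gt1 x0 Lf dec).
apply: near_cvg0_ereal => [n|e e0]; first exact: cLnorm_ge0.
(* The constant [C] of [S'] has no known sign; [|C| + 1] is positive and at least [C]. *)
have C1 : 0 < `|C| + 1 by rewrite ltr_wpDl.
have eC : 0 < e / (`|C| + 1) by rewrite divr_gt0.
apply: filterS (tail_small dec eC) => n small.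
have [Ht tle] := H1_tail hM q_gt1 x0 Lf dec n.
have Hsn := H1_partial_sum hM q_gt1 x0 dec n.
(* Since [S'] agrees with [T] on [s n], the error is the value of [S'] on the tail, where its H^1
   bound applies. *)
have S'e : (fun x => S' f x - T (s n) x) = S' (fun x => f x - s n x) %[ae mu].
  have := lin_linear S'_lin (-1) Hsn Hf; have := S'_ext _ (Hs n).
  have -> : (fun x => -1 * \sum_(0 <= j < n) lam j * a j x + f x) = (fun x => f x - s n x).
    by apply/funext => x; rewrite mulN1r addrC.
  by apply: filterS2 => x /(_ I) <- /(_ I) ->; rewrite mulN1r addrC.
have LTs := lin_L1 T_lin (Hs n).
have LS't := lin_L1 S'_lin Ht.
rewrite (cLnorm1_ae (cmeasurable_sub (cLp1_measurable LS'f) (cLp1_measurable LTs))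
  (cLp1_measurable LS't) S'e).
apply: (le_trans (S'_bd _ Ht)).
have norm0 : (0 <= H1norm rho mu q (fun x => f x - s n x)%R)%E.
  apply: le_ereal_inf_tmp => _ [lam' [a' [_ ->]]].
  by apply: nneseries_ge0 => j _ _; rewrite lee_fin cabs_ge0.
apply: (@le_trans _ _ ((`|C| + 1)%:E * (e / (`|C| + 1))%:E)%E); last first.
  by rewrite -EFinM mulrC divfK// gt_eqF.
have tail0 : 0 <= fine (\sum_(0 <= j <oo) (cabs (lam j))%:E)%E -
    \sum_(0 <= j < n) cabs (lam j).
  by rewrite -lee_fin (le_trans norm0 tle).
have le_eC : (H1norm rho mu q (fun x => f x - s n x)%R <= (e / (`|C| + 1))%:E)%E.
  by apply: (le_trans tle); rewrite lee_fin (le_trans _ small)// mulr_natl mulr2n lerDl.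
apply: (@le_trans _ _ ((`|C| + 1)%:E * H1norm rho mu q (fun x => f x - s n x)%R)%E).
  by apply: lee_wpmul2r => //; rewrite lee_fin (le_trans (ler_norm _))// lerDl.
by apply: lee_wpmul2l => //; rewrite lee_fin ltW.
Qed.
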